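(* Let $F=\mathbb{F}(n;n_1,\dots,n_k)=SU(n)/S(U(n_1)\times\cdots\times U(n_k))$ with $n=n_1+\cdots+n_k$, and let $X\in\mathfrak{m}\cong T_oF$ be represented by the skew-Hermitian block matrix $A=(a_{ij})_{1\le i,j\le k}$, $a_{ij}\in M_{n_i,n_j}(\mathbb{C})$, $a_{ii}=0$. Then: (i) $X$ is an equigeodesic vector if and only if $a_{ij}a_{jm}=0$ for all distinct $i,j,m$ with $1\le i,j,m\le k$. (ii) The eigenvalues of $A$ are commensurate if and only if $X$ defines a closed Killing field on $F$.
   Context: Let $G=SU(n)$, $K=S(U(n_1)\times\cdots\times U(n_k))$ (block-diagonal matrices in $SU(n)$, with $k\ge 2$ and $n_i\ge 1$), with Lie algebras $\mathfrak{g}=\mathfrak{su}(n)$ and $\mathfrak{k}$, and let $o=eK$. Let $\langle\cdot,\cdot\rangle$ be the Cartan-Killing form of $\mathfrak{g}$ and $\mathfrak{m}=\mathfrak{k}^{\perp}$; $\mathfrak{m}$ consists of the skew-Hermitian $n\times n$ matrices $A=(a_{ij})_{1\le i,j\le k}$, $a_{ij}\in M_{n_i,n_j}(\mathbb{C})$, with all diagonal blocks $a_{ii}=0$, and is identified with $T_oF$. An invariant metric on $F$ is a $G$-invariant Riemannian metric $g$; it is determined by an operator $\Lambda:\mathfrak{m}\to\mathfrak{m}$ via $g_o(X,Y)=-\langle\Lambda X,Y\rangle$, and the operators arising are those of the form $(\Lambda A)_{ij}=\lambda_{ij}a_{ij}$ for $i\ne j$, where $\lambda_{ij}=\lambda_{ji}>0$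 are arbitrary positive reals. A vector $X$ is called an equigeodesic vector if the curve $\gamma(t)=(\exp tX)\cdot o$ is a geodesic of $F$ with respect to every invariant metric (constant curves are counted as geodesics). The Killing field defined by $X\in\mathfrak{m}$ is the vector field $X^*$ on $F$ given by $X^*(pK)=\frac{d}{dt}\big((\exp tX)\cdot pK\big)\big|_{t=0}$. A vector field is closed if every one of its trajectories is closed (i.e. periodic, constant trajectories included). Complex numbers are commensurate if they are pairwise linearly dependent over $\mathbb{Q}$. *)

(* Defs.v *)
From HB Require Import structures.
From mathcomp Require Import all_boot all_order all_algebra.
From mathcomp Require Import complex.
From mathcomp Require Import all_classical all_reals all_analysis.

Set Implicit Arguments.
Unset Strict Implicit.
Unset Printing Implicit Defensive.

Import Order.TTheory GRing.Theory Num.Theory.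
Import numFieldNormedType.Exports.

Local Open Scope classical_set_scope.
Local Open Scope complex_scope.
Local Open Scope sesquilinear_scope.
Local Open Scope ring_scope.

Section SmoothMaps.
Context {R : realType}.

Fixpoint smooth_upto (m : nat) (V : normedModType R) (U : set V) (f : V -> R) :
    Prop :=
  match m with
  | 0 => forall x, U x -> {for x, continuous f}
  | m'.+1 => (forall x, U x -> differentiable f x) /\
             (forall v, smooth_upto m' U (fun x => 'D_v f x))
  end.

(* f is C^oo on U; U is always open where this is used. *)
Definition smooth (V : normedModType R) (U : set V) (f : V -> R) : Prop :=
  forall m, smooth_upto m U f.

Definition smooth_mx (V : normedModType R) (m n : nat) (U : set V)
    (h : V -> 'M[R[i]]_(m, n)) : Prop :=
  forall i j, smooth U (fun x => complex.Re (h x i j)) /\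
              smooth U (fun x => complex.Im (h x i j)).

(* R[i] carries no R-normed structure here, so complex matrices are
   differentiated entrywise, on real and imaginary parts. *)
Definition derive_mx (V : normedModType R) (m n : nat)
    (h : V -> 'M[R[i]]_(m, n)) (x v : V) : 'M[R[i]]_(m, n) :=
  \matrix_(i, j) ('D_v (fun y => complex.Re (h y i j)) x
                  +i* 'D_v (fun y => complex.Im (h y i j)) x).

(* exp A = \sum_m A^m / m!, the limit being taken entrywise. *)
Definition expm (n : nat) (A : 'M[R[i]]_n) : 'M[R[i]]_n :=
  \matrix_(i, j)
    (limn (series (fun m : nat => complex.Re ((A ^+ m) i j) / m`!%:R))
     +i* limn (series (fun m : nat => complex.Im ((A ^+ m) i j) / m`!%:R))).

End SmoothMaps.

Section KillingForm.
Context {R : realType} {n : nat}.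

Definition adm (X Z : 'M[R[i]]_n) : 'M[R[i]]_n := X *m Z - Z *m X.

(* tr (ad X o ad Y). For X, Y in su(n) the real trace over su(n) equals the
   complex trace over its complexification sl_n(C), and also the trace over
   gl_n(C) = sl_n(C) + C.1, because ad X and ad Y kill the centre. *)
Definition killing (X Y : 'M[R[i]]_n) : R :=
  complex.Re (\tr (lin_mx (adm X) *m lin_mx (adm Y))).

End KillingForm.

Section Flag.
Context {R : realType} {k : nat} {p_ : 'I_k -> nat}.

Local Notation C := (R[i]).
Local Notation n := (\sum_i p_ i)%N.
Local Notation M := ('M[C]_n).

Definition SU : set M := [set g | g \is unitarymx /\ \det g = 1].

(* The diagonal blocks of such a g are automatically unitary. *)
Definition SK : set M :=
  [set g | SU g /\ forall i j : 'I_k, i != j -> submxblock g i j = 0].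

(* The points of F = SU / SK are represented by the left cosets g SK. *)
Definition origin : set M := SK.
Definition act (g : M) (p : set M) : set M := [set g *m x | x in p].

Definition mspace : set M :=
  [set A | A ^t* = - A /\ forall i : 'I_k, submxblock A i i = 0].

(* On su(n) this is the orthogonal projection onto m, along k. *)
Definition proj_m (A : M) : M :=
  \mxblock_(i, j) (if i == j then 0 else submxblock A i j).

Definition Lambda (lam : 'I_k -> 'I_k -> R) (A : M) : M :=
  \mxblock_(i, j) ((lam i j)%:C *: submxblock A i j).

Definition is_lambda (lam : 'I_k -> 'I_k -> R) : Prop :=
  forall i j, i != j -> 0 < lam i j /\ lam i j = lam j i.

(* The invariant metric at o, on m = T_o F. *)
Definition metric_o (lam : 'I_k -> 'I_k -> R) (X Y : M) : R :=
  - killing (Lambda lam X) Y.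

(* Smooth maps into F are handled through smooth lifts to SU(n); they exist
   locally, and globally over the real line, as SU(n) -> F is a principal
   bundle. *)
Definition lifts (V : normedModType R) (U : set V) (h : V -> M)
    (f : V -> set M) : Prop :=
  smooth_mx U h /\ forall x, U x -> SU (h x) /\ f x = act (h x) origin.

(* For f = h SK and v a tangent vector at x, the vector df_x(v) translated
   from f(x) to o by h(x)^-1 = h(x)^t*, as an element of m. *)
Definition diff_o (V : normedModType R) (h : V -> M) (x v : V) : M :=
  proj_m ((h x)^t* *m derive_mx h x v).

(* The vector df_x(v) itself. The tangent space at g SK is identified with
   g m g^-1, which depends on the coset only: the class of (g, Y) in
   SU x_SK m = TF is sent to g Y g^-1. *)
Definition diff_F (V : normedModType R) (h : V -> M) (x v : V) : M :=
  h x *m diff_o h x v *m (h x)^t*.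

Section Coordinates.
Context {d : nat}.
Implicit Types (U : set 'rV[R]_d) (h : 'rV[R]_d -> M).

(* x |-> h(x) SK is a diffeomorphism of U onto an open subset of F. *)
Definition parametrization U h : Prop :=
  [/\ open U,
      lifts U h (fun x => act (h x) origin),
      set_inj U (fun x => act (h x) origin) &
      forall x, U x -> set_bij [set: 'rV[R]_d] mspace (diff_o h x)].

Definition partial (a : 'I_d) (f : 'rV[R]_d -> R) (x : 'rV[R]_d) : R :=
  'D_(delta_mx 0 a) f x.

(* The components of the invariant metric in these coordinates: left
   translations are isometries, so vectors may be moved to o. *)
Definition gram (lam : 'I_k -> 'I_k -> R) h (x : 'rV[R]_d) : 'M[R]_d :=
  \matrix_(a, b) metric_o lam (diff_o h x (delta_mx 0 a))
                              (diff_o h x (delta_mx 0 b)).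

Definition christoffel (lam : 'I_k -> 'I_k -> R) h (c a b : 'I_d)
    (x : 'rV[R]_d) : R :=
  2^-1 * \sum_(l < d) invmx (gram lam h x) c l *
    (partial a (fun y => gram lam h y b l) x
     + partial b (fun y => gram lam h y a l) x
     - partial l (fun y => gram lam h y a b) x).

End Coordinates.

Definition smooth_curve (gamma : R -> set M) : Prop :=
  exists h : R -> M, lifts (V := R^o) setT h gamma.

Definition geodesic (lam : 'I_k -> 'I_k -> R) (gamma : R -> set M) : Prop :=
  smooth_curve gamma /\
  forall (d : nat) (U : set 'rV[R]_d) (h : 'rV[R]_d -> M)
         (I : set R) (x : R -> 'rV[R]_d),
    parametrization U h -> open I ->
    (forall c, smooth (V := R^o) I (fun t => x t 0 c)) ->
    (forall t, I t -> U (x t) /\ gamma t = act (h (x t)) origin) ->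
    forall t, I t -> forall c : 'I_d,
      derive1n 2 (fun s => x s 0 c) t
      + \sum_(a < d) \sum_(b < d) christoffel lam h c a b (x t)
          * derive1 (fun s => x s 0 a) t * derive1 (fun s => x s 0 b) t = 0.

Definition equigeodesic (X : M) : Prop :=
  forall lam, is_lambda lam ->
    geodesic lam (fun t : R => act (expm (t%:C *: X)) origin).

(* X^* at g SK, as an element of g m g^-1; it depends on the coset only. *)
Definition killing_field (X g : M) : M :=
  diff_F (V := R^o) (fun t : R => expm (t%:C *: X) *m g) 0 1.

Definition trajectory (X : M) (gamma : R -> set M) : Prop :=
  exists h : R -> M, lifts (V := R^o) setT h gamma /\
    forall t : R, diff_F (V := R^o) h t 1 = killing_field X (h t).

Definition closed_killing_field (X : M) : Prop :=
  forall gamma, trajectory X gamma ->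
    exists2 T : R, 0 < T & forall t, gamma (t + T) = gamma t.

End Flag.

Definition commensurate {R : realType} (a b : R[i]) : Prop :=
  exists q r : rat, (q != 0) || (r != 0) /\ ratr q * a + ratr r * b = 0.

Definition commensurate_eigenvalues {R : realType} (n : nat) (A : 'M[R[i]]_n) :
    Prop :=
  forall a b, eigenvalue A a -> eigenvalue A b -> commensurate a b.

(* Main.v *)
From HB Require Import structures.
From Pilot Require Import Defs.
From mathcomp Require Import all_boot all_order all_algebra.
From mathcomp Require Import complex.
From mathcomp Require Import all_classical all_reals all_analysis.
From mathcomp Require Import ring lra.

(** Notation of this comment: K is the block-diagonal subgroup, m the tangent
    space at o, L the operator Lambda of an invariant metric, [A, B] the
    commutator, and h(x) K a parametrization of F with frame theta_l(x), the
    projection to m of h^-1 d_l h. On matrices of trace zero the Killing form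
    is a positive multiple of Re tr(A B), so every metric computation is a
    computation with traces of products of matrices whose blocks vanish on, or
    off, the diagonal.

    Part (i) rests on the identity behind Arnold's description of geodesics.
    Let x(t) be coordinates of exp(tX) o, let H = h(x(t)) and u = H^-1 X H.
    Since exp(-tX) H stays in K, H^-1 H' = u + Z with Z block diagonal, so u
    is the velocity transported to o. The Euler-Lagrange expression of the
    energy in the direction e_l contains derivatives of the frame only through
    the combination that the structure equation d omega = - omega wedge omega
    turns into a commutator; symmetry of second derivatives is what makes this
    available for a smooth lift h (schwarz). Invariance of the trace form then
    collapses everything to Re tr(theta_l [u, L u]) (euler_arnold_trace,
    euler_lagrange, geodesic_equation_chart). Conjugation by elements of K
    commutes with L, so [u, L u] is conjugate to [X, L X]: if the latter is
    zero, the curve is a geodesic. For the converse a single parametrization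
    is enough. Take a real basis E_0 = X, E_1, ... of m and multiply the
    one-parameter groups exp(x_a E_a); the curve is then the first coordinate
    axis, the frame at the origin is (E_a), and the equation at t = 0 says
    that [X, L X], an element of m, is orthogonal to m. That the product is a
    parametrization near 0 follows from the mean value theorem applied to a
    smooth function of the coset whose Jacobian at 0 is the identity
    (chart_parametrization). Finally the (i, l) block of [A, L A] is sum_j
    (lambda_jl - lambda_ij) a_ij a_jl, and the metric with lambda = 2 on a
    single pair {j, l} and 1 elsewhere isolates one product (lie_weight_eq0).

    Part (ii). Every trajectory has the form t -> exp(tX) g o: if h lifts a
    trajectory, the curve w = exp(-tX) h satisfies w' = w Z with Z block
    diagonal, hence w D w^-1 is constant for the diagonal matrix D that labels
    the blocks, and so w(0)^-1 w(t) is in K (trajectory_flow). Commensurate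
    eigenvalues give one T > 0 with exp(TX) = 1. Conversely, conjugating by a
    well-chosen g, the projection on one block becomes a projection without
    zero off-diagonal entry in an eigenbasis of X (generic_projection). If the
    trajectory through g o has period T, then exp(TX) commutes with that
    projection, so it is a scalar; its determinant is 1, so exp(nTX) = 1, and
    every eigenvalue is an integer multiple of 2 pi i / (nT)
    (commensurate_of_closed). *)

Set Implicit Arguments.
Unset Strict Implicit.
Unset Printing Implicit Defensive.

Import Order.TTheory GRing.Theory Num.Theory.
Import numFieldNormedType.Exports.

Local Open Scope classical_set_scope.
Local Open Scope complex_scope.
Local Open Scope sesquilinear_scope.
Local Open Scope ring_scope.

Local Notation derive_mx := Pilot.Defs.derive_mx.

(** * Differentiation of complex matrix-valued maps *)

Section ComplexDerivative.
Context {R : realType} {V : normedModType R}.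
Local Notation C := R[i].

Lemma cReM (x y : C) :
  complex.Re (x * y) = complex.Re x * complex.Re y - complex.Im x * complex.Im y.
Proof. by case: x y => [a b] [c d]. Qed.

Lemma cImM (x y : C) :
  complex.Im (x * y) = complex.Re x * complex.Im y + complex.Im x * complex.Re y.
Proof. by case: x y => [a b] [c d]. Qed.

Lemma cReD (x y : C) : complex.Re (x + y) = complex.Re x + complex.Re y.
Proof. by case: x y => [a b] [c d]. Qed.

Lemma cImD (x y : C) : complex.Im (x + y) = complex.Im x + complex.Im y.
Proof. by case: x y => [a b] [c d]. Qed.

Lemma cReN (x : C) : complex.Re (- x) = - complex.Re x.
Proof. by case: x. Qed.

Lemma cImN (x : C) : complex.Im (- x) = - complex.Im x.
Proof. by case: x. Qed.

Lemma cReJ (x : C) : complex.Re (Num.conj x) = complex.Re x.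
Proof. by case: x. Qed.

Lemma cImJ (x : C) : complex.Im (Num.conj x) = - complex.Im x.
Proof. by case: x. Qed.

Lemma cRe_sum (I : Type) (r : seq I) (P : pred I) (F : I -> C) :
  complex.Re (\sum_(i <- r | P i) F i) = \sum_(i <- r | P i) complex.Re (F i).
Proof. exact: (big_morph _ cReD). Qed.

Lemma cIm_sum (I : Type) (r : seq I) (P : pred I) (F : I -> C) :
  complex.Im (\sum_(i <- r | P i) F i) = \sum_(i <- r | P i) complex.Im (F i).
Proof. exact: (big_morph _ cImD). Qed.

Lemma cReZ (a : R) (x : C) : complex.Re (a%:C * x) = a * complex.Re x.
Proof. by case: x => x y /=; rewrite mul0r subr0. Qed.

Lemma cImZ (a : R) (x : C) : complex.Im (a%:C * x) = a * complex.Im x.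
Proof. by case: x => x y /=; rewrite mul0r addr0. Qed.

Lemma complex_ext (x y : C) :
  complex.Re x = complex.Re y -> complex.Im x = complex.Im y -> x = y.
Proof. by case: x y => [a b] [c d] /= -> ->. Qed.

(** R[i] is not a normed module over R here, so derivatives are taken on real
    and imaginary parts; the relational form carries differentiability along. *)
Definition is_cderive (x v : V) (f : V -> C) (df : C) : Prop :=
  is_derive x v (fun y => complex.Re (f y)) (complex.Re df) /\
  is_derive x v (fun y => complex.Im (f y)) (complex.Im df).

Definition is_mxderive m n (x v : V) (h : V -> 'M[C]_(m, n)) (dh : 'M[C]_(m, n)) :=
  forall i j, is_cderive x v (fun y => h y i j) (dh i j).

Implicit Types (x v : V).

Lemma is_cderive_eq x v f df df' :
  is_cderive x v f df -> df = df' -> is_cderive x v f df'.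
Proof. by move=> ? <-. Qed.

Lemma is_cderive_cst x v (c : C) : is_cderive x v (fun=> c) 0.
Proof. by split; exact: is_derive_cst. Qed.

Lemma is_cderiveD x v f g df dg : is_cderive x v f df -> is_cderive x v g dg ->
  is_cderive x v (fun y => f y + g y) (df + dg).
Proof.
move=> [f1 f2] [g1 g2]; split; rewrite ?cReD ?cImD.
- rewrite (_ : (fun _ => _) = (fun y => complex.Re (f y)) + (fun y => complex.Re (g y))).
    exact: is_deriveD.
  by apply/funext => y; rewrite cReD.
- rewrite (_ : (fun _ => _) = (fun y => complex.Im (f y)) + (fun y => complex.Im (g y))).
    exact: is_deriveD.
  by apply/funext => y; rewrite cImD.
Qed.

Lemma is_cderiveM x v f g df dg : is_cderive x v f df -> is_cderive x v g dg ->
  is_cderive x v (fun y => f y * g y) (df * g x + f x * dg).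
Proof.
move=> [f1 f2] [g1 g2]; split; rewrite ?cReD ?cImD ?cReM ?cImM.
- rewrite (_ : (fun _ => _) =
     (fun y => complex.Re (f y)) * (fun y => complex.Re (g y)) -
     (fun y => complex.Im (f y)) * (fun y => complex.Im (g y))).
    by apply: is_derive_eq; rewrite /GRing.scale /=; ring.
  by apply/funext => y; rewrite cReM.
- rewrite (_ : (fun _ => _) =
     (fun y => complex.Re (f y)) * (fun y => complex.Im (g y)) +
     (fun y => complex.Im (f y)) * (fun y => complex.Re (g y))).
    by apply: is_derive_eq; rewrite /GRing.scale /=; ring.
  by apply/funext => y; rewrite cImM.
Qed.

Lemma is_cderiveJ x v f df : is_cderive x v f df ->
  is_cderive x v (fun y => Num.conj (f y)) (Num.conj df).
Proof.
move=> [f1 f2]; split.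
  rewrite cReJ (_ : (fun _ => _) = fun y => complex.Re (f y)) //.
  by apply/funext => y; rewrite cReJ.
rewrite cImJ (_ : (fun _ => _) = - fun y => complex.Im (f y)).
  exact: is_deriveN.
by apply/funext => y; rewrite cImJ.
Qed.

Lemma is_cderive_sum x v (I : Type) (r : seq I) (f : I -> V -> C) (df : I -> C) :
  (forall i, is_cderive x v (f i) (df i)) ->
  is_cderive x v (fun y => \sum_(i <- r) f i y) (\sum_(i <- r) df i).
Proof.
move=> fP; elim: r => [|i r IH].
  rewrite big_nil (_ : (fun _ => _) = fun=> 0); first exact: is_cderive_cst.
  by apply/funext => y; rewrite big_nil.
rewrite big_cons (_ : (fun _ => _) = fun y => f i y + \sum_(j <- r) f j y).
  exact: is_cderiveD.
by apply/funext => y; rewrite big_cons.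
Qed.

Lemma near_is_cderive x v f g df : (\forall y \near x, f y = g y) ->
  is_cderive x v f df -> is_cderive x v g df.
Proof.
move=> fg [f1 f2]; split.
  by apply: (near_eq_is_derive _ f1); near=> y; congr complex.Re; near: y.
by apply: (near_eq_is_derive _ f2); near=> y; congr complex.Im; near: y.
Unshelve. all: by end_near. Qed.

Section Matrices.
Variables (m n : nat).
Implicit Types (h : V -> 'M[C]_(m, n)).

Lemma is_mxderive_val x v h dh : is_mxderive x v h dh -> derive_mx h x v = dh.
Proof.
move=> hP; apply/matrixP => i j; rewrite mxE.
by have [h1 h2] := hP i j; rewrite !derive_val; case: (dh i j).
Qed.

Lemma is_mxderive_unique x v h dh dh' :
  is_mxderive x v h dh -> is_mxderive x v h dh' -> dh = dh'.
Proof. by move=> /is_mxderive_val <- /is_mxderive_val <-. Qed.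

Lemma is_mxderive_eq x v h dh dh' :
  is_mxderive x v h dh -> dh = dh' -> is_mxderive x v h dh'.
Proof. by move=> ? <-. Qed.

Lemma is_mxderive_cst x v (A : 'M[C]_(m, n)) : is_mxderive x v (fun=> A) 0.
Proof. by move=> i j; rewrite mxE; exact: is_cderive_cst. Qed.

Lemma is_mxderive_trC x v h dh : is_mxderive x v h dh ->
  is_mxderive x v (fun y => (h y)^t*) (dh^t*).
Proof.
move=> hP i j; rewrite !mxE.
rewrite (_ : (fun _ => _) = fun y => Num.conj (h y j i)).
  exact: is_cderiveJ.
by apply/funext => y; rewrite !mxE.
Qed.

(** Both the projection to the off-diagonal blocks and the operator of a
    metric multiply entries by constants; this differentiates them. *)
Lemma is_mxderive_weight x v h dh (w : 'I_m -> 'I_n -> C) : is_mxderive x v h dh ->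
  is_mxderive x v (fun y => \matrix_(i, j) (w i j * h y i j))
    (\matrix_(i, j) (w i j * dh i j)).
Proof.
move=> hP i j; rewrite mxE.
rewrite (_ : (fun _ => _) = fun y => w i j * h y i j).
  apply: is_cderive_eq (is_cderiveM (is_cderive_cst x v (w i j)) (hP i j)) _.
  by rewrite mul0r add0r.
by apply/funext => y; rewrite mxE.
Qed.

Lemma is_mxderive_scale x v h dh (f : V -> C) df :
  is_cderive x v f df -> is_mxderive x v h dh ->
  is_mxderive x v (fun y => f y *: h y) (df *: h x + f x *: dh).
Proof.
move=> fP hP i j; rewrite !mxE.
rewrite (_ : (fun _ => _) = fun y => f y * h y i j); first exact: is_cderiveM.
by apply/funext => y; rewrite mxE.
Qed.

Lemma is_mxderive_sum x v (I : Type) (r : seq I) (h : I -> V -> 'M[C]_(m, n))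
    (dh : I -> 'M[C]_(m, n)) :
  (forall i, is_mxderive x v (h i) (dh i)) ->
  is_mxderive x v (fun y => \sum_(i <- r) h i y) (\sum_(i <- r) dh i).
Proof.
move=> hP i j; rewrite summxE.
rewrite (_ : (fun _ => _) = fun y => \sum_(k <- r) h k y i j).
  by apply: is_cderive_sum => k; exact: hP.
by apply/funext => y; rewrite summxE.
Qed.

Lemma near_is_mxderive x v h g dh : (\forall y \near x, h y = g y) ->
  is_mxderive x v h dh -> is_mxderive x v g dh.
Proof.
move=> hg hP i j; apply: near_is_cderive (hP i j).
by near=> y; congr (fun_of_matrix _ i j); near: y.
Unshelve. all: by end_near. Qed.

End Matrices.

Lemma is_mxderiveM m n p x v (h : V -> 'M[C]_(m, n)) (g : V -> 'M[C]_(n, p)) dh dg :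
  is_mxderive x v h dh -> is_mxderive x v g dg ->
  is_mxderive x v (fun y => h y *m g y) (dh *m g x + h x *m dg).
Proof.
move=> hP gP i j; rewrite !mxE -big_split /=.
rewrite (_ : (fun _ => _) = fun y => \sum_k h y i k * g y k j).
  by apply: is_cderive_sum => k; exact: is_cderiveM.
by apply/funext => y; rewrite mxE.
Qed.

Lemma is_mxderiveMl m n p x v (A : 'M[C]_(m, n)) (g : V -> 'M[C]_(n, p)) dg :
  is_mxderive x v g dg -> is_mxderive x v (fun y => A *m g y) (A *m dg).
Proof.
move=> gP; apply: is_mxderive_eq (is_mxderiveM (is_mxderive_cst x v A) gP) _.
by rewrite mul0mx add0r.
Qed.

Lemma is_mxderiveMr m n p x v (A : 'M[C]_(n, p)) (g : V -> 'M[C]_(m, n)) dg :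
  is_mxderive x v g dg -> is_mxderive x v (fun y => g y *m A) (dg *m A).
Proof.
move=> gP; apply: is_mxderive_eq (is_mxderiveM gP (is_mxderive_cst x v A)) _.
by rewrite mulmx0 addr0.
Qed.

Lemma is_derive_retr n x v (h : V -> 'M[C]_n) dh :
  is_mxderive x v h dh ->
  is_derive x v (fun y => complex.Re (\tr (h y))) (complex.Re (\tr dh)).
Proof.
by move=> hP; apply: (proj1 (is_cderive_sum _ _)) => i; exact: hP.
Qed.

Lemma smooth_is_derive (U : set V) (f : V -> R) x v : smooth U f -> U x ->
  is_derive x v f ('D_v f x).
Proof.
move=> fS Ux; apply: derivableP; apply: diff_derivable.
by have [/(_ x Ux)] := fS 1%N.
Qed.

Lemma smooth_derive (U : set V) (f : V -> R) v :
  smooth U f -> smooth U (fun x => 'D_v f x).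
Proof. by move=> fS m; have [_ /(_ v)] := fS m.+1. Qed.

Lemma smooth_mx_is_derive m n (U : set V) (h : V -> 'M[C]_(m, n)) x v :
  smooth_mx U h -> U x -> is_mxderive x v h (derive_mx h x v).
Proof.
move=> hS Ux i j; have [h1 h2] := hS i j.
by split; rewrite mxE /=; apply: smooth_is_derive Ux.
Qed.

Lemma smooth_mx_derive m n (U : set V) (h : V -> 'M[C]_(m, n)) v :
  smooth_mx U h -> smooth_mx U (fun x => derive_mx h x v).
Proof.
move=> hS i j; have [h1 h2] := hS i j.
by split; under [X in smooth _ X]funext do rewrite mxE /=; apply: smooth_derive.
Qed.

End ComplexDerivative.

(** * Mean value along lines, symmetry of second derivatives, chain rule *)

Section SeveralVariables.
Context {R : realType}.

(** The two difference quotients are the same function. *)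
Lemma is_derive_line (V : normedModType R) (f : V -> R) (z w : V) (t : R) :
  derivable f (z + t *: w) w ->
  is_derive (t : R^o) 1 (fun s : R^o => f (z + s *: w)) ('D_w f (z + t *: w)).
Proof.
set g := fun s : R^o => _.
have gE : (fun h : R => h^-1 *: ((g \o shift t) (h *: (1 : R^o)) - g t)) =
    (fun h : R => h^-1 *: ((f \o shift (z + t *: w)) (h *: w) - f (z + t *: w))).
  apply/funext => h; rewrite /g /=; congr (_ *: (f _ - _)).
  by rewrite [h *: _]mulr1 scalerDl addrCA.
by move=> df; apply: DeriveDef; rewrite /derivable /derive gE.
Qed.

Lemma mvt_line (V : normedModType R) (f : V -> R) (z w : V) (s : R) : 0 < s ->
  (forall t, 0 <= t <= s -> differentiable f (z + t *: w)) ->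
  exists2 t, 0 < t < s & f (z + s *: w) - f z = s * 'D_w f (z + t *: w).
Proof.
move=> s0 fD.
have fd t : 0 <= t <= s ->
    is_derive (t : R^o) 1 (fun s : R^o => f (z + s *: w)) ('D_w f (z + t *: w)).
  by move=> ht; apply: is_derive_line; apply: diff_derivable; exact: fD.
have [||t] := @MVT R (fun t => f (z + t *: w)) (fun t => 'D_w f (z + t *: w)) 0 s s0.
- by move=> t; rewrite in_itv /= => /andP[t0 ts]; apply: fd; rewrite !ltW.
- apply: derivable_within_continuous => t; rewrite in_itv /= => ht.
  by have [] := fd t ht.
rewrite in_itv /= scale0r addr0 subr0 => ht e.
by exists t; rewrite // e mulrC.
Qed.

(** Two applications of the mean value theorem, first along u to the increment
    f(z + s v) - f(z), then along v. *)
Lemma second_difference (V : normedModType R) (U : set V) (f : V -> R) (x u v : V)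
    (s : R) : 0 < s -> smooth U f ->
  (forall a b : R, 0 <= a <= s -> 0 <= b <= s -> U (x + a *: u + b *: v)) ->
  exists a b : R, [/\ 0 <= a <= s, 0 <= b <= s &
    f (x + s *: u + s *: v) - f (x + s *: u) - (f (x + s *: v) - f x)
      = s * (s * 'D_v (fun z => 'D_u f z) (x + a *: u + b *: v))].
Proof.
move=> s0 fS hU.
have s1 : 0 <= s <= s by rewrite lexx ltW.
have z1 : 0 <= (0:R) <= s by rewrite lexx ltW.
pose g z := f (z + s *: v) - f z.
have fD z : U z -> differentiable f z by have [+ _] := fS 1%N; apply.
have gD (a : R) : 0 <= a <= s -> differentiable g (x + a *: u) /\
    'D_u g (x + a *: u) = 'D_u f (x + a *: u + s *: v) - 'D_u f (x + a *: u).
  move=> ha.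
  have d1 : differentiable f (x + a *: u + s *: v) by apply/fD/hU.
  have d2 : differentiable f (x + a *: u).
    by apply: fD; have := hU a 0 ha z1; rewrite scale0r addr0.
  have e : is_diff (x + a *: u) (fun z : V => z + s *: v) id.
    have -> : (fun z : V => z + s *: v) = id + cst (s *: v) by [].
    exact: is_diff_eq (addr0 _).
  have c : is_diff (x + a *: u) (f \o (fun z : V => z + s *: v))
      ('d f (x + a *: u + s *: v) \o id).
    by apply: is_diff_comp; exact: differentiableP.
  have [gd gv] := is_diffB c (differentiableP d2).
  by split => //; rewrite !deriveE // [in LHS]gv.
have [a ha] := @mvt_line V g x u s s0 (fun t ht => (gD t ht).1).
have ha' : 0 <= a <= s by case/andP: ha => ? ?; rewrite !ltW.
rewrite (gD a ha').2 => ->.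
have [|b hb ->] := @mvt_line V (fun z => 'D_u f z) (x + a *: u) v s s0.
  by move=> b hb; have [_ /(_ u)[+ _]] := fS 2%N; apply; exact: hU.
by exists a, b; split => //; case/andP: hb => ? ?; rewrite !ltW.
Qed.

(** The second difference is symmetric in u and v, and divided by s^2 it is a
    value of either mixed derivative near x; both mixed derivatives are
    continuous. *)
Lemma schwarz (V : normedModType R) (U : set V) (f : V -> R) (x u v : V) :
  open U -> U x -> smooth U f ->
  'D_v (fun z => 'D_u f z) x = 'D_u (fun z => 'D_v f z) x.
Proof.
move=> Uo Ux fS.
have Dc u' v' : {for x, continuous (fun y => 'D_v' (fun z => 'D_u' f z) y)}.
  by have [_ /(_ u') [_ /(_ v') /= +]] := fS 2%N; apply.
apply/eqP; rewrite -subr_eq0 -normr_le0; apply/ler_addgt0Pl => /= e e0; rewrite addr0.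
have near_x u' v' : \forall y \near x,
   `|'D_v' (fun z => 'D_u' f z) x - 'D_v' (fun z => 'D_u' f z) y| < e / 2.
  by have /cvgrPdist_lt := Dc u' v'; apply; rewrite divr_gt0.
have UN : \forall y \near x, U y by exact: open_nbhs_nbhs.
have : nbhs x [set y | U y /\
   (`|'D_v (fun z => 'D_u f z) x - 'D_v (fun z => 'D_u f z) y| < e / 2 /\
   `|'D_u (fun z => 'D_v f z) x - 'D_u (fun z => 'D_v f z) y| < e / 2)].
  exact: (filterI UN (filterI (near_x u v) (near_x v u))).
move=> /nbhs_ballP [r /= r0 hr].
(* The parallelogram with sides s u and s v stays in the ball of radius r
   around x. *)
pose s := r / 2 / (`|u| + `|v| + 1).
have D0 : 0 < `|u| + `|v| + 1 by rewrite ltr_wpDl // addr_ge0.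
have s0 : 0 < s by rewrite !divr_gt0.
have inb (a b : R) u' v' : `|u'| + `|v'| = `|u| + `|v| ->
    0 <= a <= s -> 0 <= b <= s -> ball x r (x + a *: u' + b *: v').
  move=> E /andP[a0 as_] /andP[b0 bs].
  rewrite -ball_normE /ball_ /= -addrA opprD addrA subrr add0r normrN.
  apply: (@le_lt_trans _ _ (s * (`|u| + `|v| + 1))).
    rewrite -E; apply: (le_trans (ler_normD _ _)); rewrite !normrZ !ger0_norm //.
    rewrite mulrDr mulr1 mulrDr -addrA.
    apply: lerD; first by rewrite ler_wpM2r.
    by rewrite -[leLHS]addr0 lerD // ?ler_wpM2r // ltW.
  by rewrite /s divfK ?gt_eqF // ltr_pdivrMr // ltr_pMr // ltr1n.
have [a [b [ha hb e1]]] := @second_difference V U f x u v s s0 fS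
  (fun (a b : R) ha hb => (hr _ (inb a b u v erefl ha hb)).1).
have [a' [b' [ha' hb' e2]]] := @second_difference V U f x v u s s0 fS
  (fun (a b : R) ha hb => (hr _ (inb a b v u (addrC _ _) ha hb)).1).
have [_ [n1 _]] := hr _ (inb _ _ _ _ erefl ha hb).
have [_ [_ n2]] := hr _ (inb _ _ _ _ (addrC _ _) ha' hb').
have E : 'D_v (fun z => 'D_u f z) (x + a *: u + b *: v) =
         'D_u (fun z => 'D_v f z) (x + a' *: v + b' *: u).
  have sn : s != 0 by rewrite gt_eqF.
  apply: (mulfI sn); apply: (mulfI sn).
  have swap (p q m t : R) : p - q - (m - t) = p - m - (q - t) by ring.
  apply: etrans (esym e1) _; apply: etrans _ e2.
  rewrite [x + s *: v + s *: u]addrAC.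
  exact: (swap (f (x + s *: u + s *: v)) (f (x + s *: u)) (f (x + s *: v)) (f x)).
rewrite -E in n2; move: n1 n2.
set A : R := 'D_v (fun z => 'D_u f z) x; set B : R := 'D_u (fun z => 'D_v f z) x.
set D : R := 'D_v (fun z => 'D_u f z) (x + a *: u + b *: v) => n1 n2.
have -> : A - B = (A - D) - (B - D) by ring.
apply: (le_trans (ler_normB _ _)).
have -> : e = e / 2 + e / 2 by exact: splitr.
have m1 := ltW n1; have m2 := ltW n2.
by apply: lerD; [exact m1 | exact m2].
Unshelve. all: by end_near. Qed.

Lemma derive_coord d (f : 'rV[R]_d -> R) (x v : 'rV[R]_d) : differentiable f x ->
  'D_v f x = \sum_(a < d) v 0 a * 'D_(delta_mx 0 a) f x.
Proof.
move=> fD; rewrite deriveE // [in LHS](row_sum_delta v) linear_sum /=.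
by apply: eq_bigr => a _; rewrite linearZ /= deriveE.
Qed.

Lemma is_derive_chain d (f : 'rV[R]_d -> R) (x : R -> 'rV[R]_d) (t : R)
    (dx : 'I_d -> R) :
  differentiable f (x t) ->
  (forall a, is_derive (t : R^o) 1 (fun s : R^o => x s 0 a) (dx a)) ->
  is_derive (t : R^o) 1 (fun s : R^o => f (x s))
    (\sum_(a < d) dx a * 'D_(delta_mx 0 a) f (x t)).
Proof.
move=> fD xD.
have xd : derivable (x : R^o -> _) t 1.
  by apply/derivable_mxP => i j; rewrite ord1; have [] := xD j.
have xdiff : differentiable (x : R^o -> _) t by apply/derivable1_diffP.
have cd : differentiable (f \o x : R^o -> R) t by apply: differentiable_comp.
apply: DeriveDef; first exact: diff_derivable.
rewrite (_ : (fun s => f (x s)) = (f \o x)) // deriveE // diff_comp //=.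
rewrite -deriveE // derive_coord //; apply: eq_bigr => a _.
by rewrite -deriveE // (mathcomp.analysis.derive.derive_mx xd) mxE derive_val.
Qed.

Local Notation C := R[i].

(** The derivative of a composite in terms of partial derivatives, the form in
    which Christoffel symbols see it. *)
Lemma is_mxderive_chain m n d (U : set 'rV[R]_d) (h : 'rV[R]_d -> 'M[C]_(m, n))
    (x : R -> 'rV[R]_d) (t : R) (dx : 'I_d -> R) :
  smooth_mx U h -> U (x t) ->
  (forall a, is_derive (t : R^o) 1 (fun s : R^o => x s 0 a) (dx a)) ->
  is_mxderive (t : R^o) 1 (fun s : R^o => h (x s))
    (\sum_(a < d) (dx a)%:C *: derive_mx h (x t) (delta_mx 0 a)).
Proof.
move=> hS Ut xD i j; have [h1 h2] := hS i j.
split; rewrite summxE ?cRe_sum ?cIm_sum.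
- under eq_bigr do rewrite mxE cReZ mxE /=.
  by apply: is_derive_chain => //; have [+ _] := h1 1%N; apply.
- under eq_bigr do rewrite mxE cImZ mxE /=.
  by apply: is_derive_chain => //; have [+ _] := h2 1%N; apply.
Qed.

Lemma derive_mx_coord m n d (U : set 'rV[R]_d) (h : 'rV[R]_d -> 'M[C]_(m, n)) x v :
  smooth_mx U h -> U x ->
  derive_mx h x v = \sum_(a < d) (v 0 a)%:C *: derive_mx h x (delta_mx 0 a).
Proof.
move=> hS Ux; apply/matrixP => i j; rewrite mxE summxE.
have [h1 h2] := hS i j.
have [d1 _] := h1 1%N; have [d2 _] := h2 1%N.
apply: complex_ext; rewrite /= ?cRe_sum ?cIm_sum derive_coord; try by [apply: d1|apply: d2].
- by apply: eq_bigr => a _; rewrite mxE cReZ mxE.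
- by apply: eq_bigr => a _; rewrite mxE cImZ mxE.
Qed.

Lemma schwarz_mx (V : normedModType R) m n (U : set V) (h : V -> 'M[C]_(m, n)) x u v :
  open U -> U x -> smooth_mx U h ->
  derive_mx (fun y => derive_mx h y u) x v = derive_mx (fun y => derive_mx h y v) x u.
Proof.
move=> Uo Ux hS; apply/matrixP => i j.
have [h1 h2] := hS i j.
have e w : (fun y => complex.Re (derive_mx h y w i j)) =
           (fun y => 'D_w (fun z => complex.Re (h z i j)) y).
  by apply/funext => y; rewrite mxE.
have e' w : (fun y => complex.Im (derive_mx h y w i j)) =
           (fun y => 'D_w (fun z => complex.Im (h z i j)) y).
  by apply/funext => y; rewrite mxE.
have D w z : derive_mx (fun y => derive_mx h y w) x z i j =
    'D_z (fun y => 'D_w (fun z => complex.Re (h z i j)) y) x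
    +i* 'D_z (fun y => 'D_w (fun z => complex.Im (h z i j)) y) x.
  by rewrite mxE e e'.
apply: etrans (D u v) _; apply: etrans _ (esym (D v u)).
have s1 := schwarz u v Uo Ux h1.
have s2 := schwarz u v Uo Ux h2.
exact (f_equal2 (@Complex R) s1 s2).
Qed.

End SeveralVariables.

(** * Smooth functions form an algebra *)

Section SmoothFunctions.
Context {R : realType} {V : normedModType R}.
Implicit Types (f g : V -> R).

Lemma smooth_uptoW m (U : set V) f : smooth_upto m.+1 U f -> smooth_upto m U f.
Proof.
elim: m f => [|m IH] f [fD fS].
  by move=> x /fD; exact: differentiable_continuous.
by split=> [//|v]; apply: IH; exact: fS.
Qed.

Lemma smooth_upto_sub m (U W : set V) f :
  U `<=` W -> smooth_upto m W f -> smooth_upto m U f.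
Proof.
move=> UW; elim: m f => [|m IH] f /=; first by move=> fW x /UW; exact: fW.
by move=> [fD fS]; split=> [x /UW/fD //|v]; apply: IH; exact: fS.
Qed.

Lemma smooth_sub (U W : set V) f : U `<=` W -> smooth W f -> smooth U f.
Proof. by move=> UW fW m; exact: smooth_upto_sub UW (fW m). Qed.

Lemma smooth_cst (c : R) : smooth setT (fun _ : V => c).
Proof.
move=> m; elim: m c => [|m IH] c /=; first by move=> x _; exact: cvg_cst.
split=> [x _|v]; first exact: differentiable_cst.
have -> : (fun x => 'D_v (fun _ : V => c) x) = fun=> 0 by apply/funext => x; exact: derive_cst.
exact: IH.
Qed.

Lemma smooth_uptoD m f g : smooth_upto m setT f -> smooth_upto m setT g ->
  smooth_upto m setT (fun x => f x + g x).
Proof.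
elim: m f g => [|m IH] f g.
  by move=> fC gC x xT; apply: continuousD; [exact: fC|exact: gC].
move=> [fD fS] [gD gS]; split=> [x xT|v].
  by apply: differentiableD; [exact: fD|exact: gD].
rewrite (_ : (fun x => 'D_v _ x) = fun x => 'D_v f x + 'D_v g x).
  by apply: IH; [exact: fS|exact: gS].
apply/funext => x.
by rewrite (deriveD (f := f)) //; apply: diff_derivable; [exact: fD|exact: gD].
Qed.

Lemma smooth_uptoM m f g : smooth_upto m setT f -> smooth_upto m setT g ->
  smooth_upto m setT (fun x => f x * g x).
Proof.
elim: m f g => [|m IH] f g.
  by move=> fC gC x xT; apply: continuousM; [exact: fC|exact: gC].
move=> fS1 gS1; have fS0 := smooth_uptoW fS1; have gS0 := smooth_uptoW gS1.
move: fS1 gS1 => [fD fS] [gD gS]; split=> [x xT|v].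
  by apply: differentiableM; [exact: fD|exact: gD].
rewrite (_ : (fun x => 'D_v _ x) = fun x => f x * 'D_v g x + g x * 'D_v f x).
  by apply: smooth_uptoD; apply: IH => //; [exact: gS|exact: fS].
apply/funext => x.
by rewrite (deriveM (f := f)) //; apply: diff_derivable; [exact: fD|exact: gD].
Qed.

Lemma smoothD f g : smooth setT f -> smooth setT g ->
  smooth setT (fun x => f x + g x).
Proof. by move=> fS gS m; exact: smooth_uptoD. Qed.

Lemma smoothM f g : smooth setT f -> smooth setT g ->
  smooth setT (fun x => f x * g x).
Proof. by move=> fS gS m; exact: smooth_uptoM. Qed.

Lemma smoothN f : smooth setT f -> smooth setT (fun x => - f x).
Proof.
move=> fS; rewrite (_ : (fun x => _) = fun x => -1 * f x).
  by apply: smoothM => //; exact: smooth_cst.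
by apply/funext => x; rewrite mulN1r.
Qed.

Lemma smooth_sum (I : Type) (r : seq I) (f : I -> V -> R) :
  (forall i, smooth setT (f i)) -> smooth setT (fun x => \sum_(i <- r) f i x).
Proof.
move=> fS; elim: r => [|i r IH].
  rewrite (_ : (fun x => _) = fun=> 0); first exact: smooth_cst.
  by apply/funext => x; rewrite big_nil.
rewrite (_ : (fun x => _) = fun x => f i x + \sum_(j <- r) f j x).
  exact: smoothD.
by apply/funext => x; rewrite big_cons.
Qed.

(** The hypothesis says that l is linear and continuous: its differential is l
    at every point. *)
Lemma smooth_linear (l : V -> R) : (forall x, is_diff x l l) -> smooth setT l.
Proof.
move=> lD [|m]; first by move=> x _; apply/differentiable_continuous; have [] := lD x.
split=> [x _|v]; first by have [] := lD x.
rewrite (_ : (fun x => 'D_v _ x) = fun=> l v); first exact: smooth_cst.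
by apply/funext => x; have [d e] := lD x; rewrite deriveE // e.
Qed.

(** cos and sin are treated together because each differentiates to the other. *)
Lemma smooth_cos_sin (l : V -> R) (c : R) : (forall x, is_diff x l l) ->
  smooth setT (fun x => cos (l x * c)) /\ smooth setT (fun x => sin (l x * c)).
Proof.
move=> lD.
have dC (y : R) : is_diff (y : R^o) (cos : R^o -> R^o) (fun h => - sin y * h).
  have d := is_derive_cos y; have d' : differentiable (cos : R^o -> R^o) y.
    by apply/derivable1_diffP; exact: derivable_cos.
  apply: DiffDef => //; apply/funext => h; rewrite diff1E // derive1E derive_val /=.
  by rewrite /GRing.scale /= mulrC.
have dS (y : R) : is_diff (y : R^o) (sin : R^o -> R^o) (fun h => cos y * h).
  have d := is_derive_sin y; have d' : differentiable (sin : R^o -> R^o) y.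
    by apply/derivable1_diffP; exact: derivable_sin.
  apply: DiffDef => //; apply/funext => h; rewrite diff1E // derive1E derive_val /=.
  by rewrite /GRing.scale /= mulrC.
have lc x : is_diff x (fun x => l x * c) (fun v => l v * c).
  have -> : (fun x => l x * c) = c *: l by apply/funext => v; rewrite mulrC.
  exact: is_diffZ (lD x).
have cD x : is_diff x (fun x => cos (l x * c)) (fun v => - sin (l x * c) * (l v * c)).
  exact: (@is_diff_comp _ _ _ _ (fun x => l x * c) _ cos _ x (lc x) (dC _)).
have sD x : is_diff x (fun x => sin (l x * c)) (fun v => cos (l x * c) * (l v * c)).
  exact: (@is_diff_comp _ _ _ _ (fun x => l x * c) _ sin _ x (lc x) (dS _)).
suff H m : smooth_upto m setT (fun x => cos (l x * c)) /\
           smooth_upto m setT (fun x => sin (l x * c)).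
  by split=> m; have [] := H m.
elim: m => [|m [IHc IHs]].
  split=> x _; apply/differentiable_continuous; first by have [] := cD x.
  by have [] := sD x.
split; (split=> [x _|v]); try by [have [] := cD x|have [] := sD x].
- rewrite (_ : (fun x => 'D_v _ x) = fun x => sin (l x * c) * - (l v * c)).
    by apply: smooth_uptoM => //; exact: smooth_cst.
  by apply/funext => x; have [d e] := cD x; rewrite deriveE // e mulNr mulrN.
- rewrite (_ : (fun x => 'D_v _ x) = fun x => cos (l x * c) * (l v * c)).
    by apply: smooth_uptoM => //; exact: smooth_cst.
  by apply/funext => x; have [d e] := sD x; rewrite deriveE // e.
Qed.

Local Notation C := R[i].

Lemma smooth_mx_cst m n (A : 'M[C]_(m, n)) : smooth_mx (V := V) setT (fun=> A).
Proof. by move=> i j; split; exact: smooth_cst. Qed.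

Lemma smooth_mxM m n p (h : V -> 'M[C]_(m, n)) (g : V -> 'M[C]_(n, p)) :
  smooth_mx setT h -> smooth_mx setT g -> smooth_mx setT (fun x => h x *m g x).
Proof.
move=> hS gS i j; split.
- rewrite (_ : (fun x => _) = fun x => \sum_k
    (complex.Re (h x i k) * complex.Re (g x k j)
     + - (complex.Im (h x i k) * complex.Im (g x k j)))).
    apply: smooth_sum => k; have [h1 h2] := hS i k; have [g1 g2] := gS k j.
    by apply: smoothD; [|apply: smoothN]; apply: smoothM.
  apply/funext => x; rewrite mxE cRe_sum; apply: eq_bigr => k _.
  by rewrite cReM.
- rewrite (_ : (fun x => _) = fun x => \sum_k
    (complex.Re (h x i k) * complex.Im (g x k j)
     + complex.Im (h x i k) * complex.Re (g x k j))).
    apply: smooth_sum => k; have [h1 h2] := hS i k; have [g1 g2] := gS k j.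
    by apply: smoothD; apply: smoothM.
  apply/funext => x; rewrite mxE cIm_sum; apply: eq_bigr => k _.
  by rewrite cImM.
Qed.

Lemma smooth_mx_trC m n (h : V -> 'M[C]_(m, n)) :
  smooth_mx setT h -> smooth_mx setT (fun x => (h x)^t*).
Proof.
move=> hS i j; have [h1 h2] := hS j i; split.
- by rewrite (_ : (fun x => _) = fun x => complex.Re (h x j i)) //;
    apply/funext => x; rewrite !mxE cReJ.
- rewrite (_ : (fun x => _) = fun x => - complex.Im (h x j i)); first exact: smoothN.
  by apply/funext => x; rewrite !mxE cImJ.
Qed.

Lemma smooth_mx_sub m n (U W : set V) (h : V -> 'M[C]_(m, n)) :
  U `<=` W -> smooth_mx W h -> smooth_mx U h.
Proof. by move=> UW hS i j; have [h1 h2] := hS i j; split; exact: smooth_sub UW _. Qed.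

End SmoothFunctions.

(** * The exponential of a skew-Hermitian matrix *)

Section SkewHermitianExponential.
Context {R : realType}.
Local Notation C := R[i].

Lemma trCM m n p (A : 'M[C]_(m, n)) (B : 'M[C]_(n, p)) :
  (A *m B)^t* = B^t* *m A^t*.
Proof. by rewrite trmx_mul map_mxM. Qed.

Lemma trCD m n (A B : 'M[C]_(m, n)) : (A + B)^t* = A^t* + B^t*.
Proof. by apply/matrixP => i j; rewrite !mxE rmorphD. Qed.

Lemma trCN m n (A : 'M[C]_(m, n)) : (- A)^t* = - A^t*.
Proof. by apply/matrixP => i j; rewrite !mxE rmorphN. Qed.

Lemma unitaryVr n (Q : 'M[C]_n) : Q \is unitarymx -> Q *m Q^t* = 1%:M.
Proof. by move/unitarymxP. Qed.

Lemma unitaryVl n (Q : 'M[C]_n) : Q \is unitarymx -> Q^t* *m Q = 1%:M.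
Proof. by move/unitaryVr/mulmx1C. Qed.

Lemma unitary_conj n (Q : 'M[C]_n) : Q \is unitarymx -> Q^t* \is unitarymx.
Proof. by move=> QU; apply/unitarymxP; rewrite trmxCK unitaryVl. Qed.

(** A skew-Hermitian matrix is normal, hence unitarily diagonalizable, and
    skewness makes the eigenvalues purely imaginary. *)
Lemma skew_spectral n (A : 'M[C]_n) : A^t* = - A ->
  exists (Q : 'M[C]_n) (th : 'I_n -> R),
    Q \is unitarymx /\ A = Q^t* *m diag_mx (\row_l (0 +i* th l)) *m Q.
Proof.
move=> As.
have [Q [D [QU AE]]] : exists (Q : 'M[C]_n) (D : 'rV[C]_n),
    Q \is unitarymx /\ A = Q^t* *m diag_mx D *m Q.
  have /orthomx_spectralP : A \is normalmx.
    by apply/normalmxP; rewrite As mulmxN mulNmx.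
  have QU := spectral_unitarymx A; rewrite invmx_unitary // => AE.
  by exists (spectralmx A), (spectral_diag A).
have DE : D = \row_l (0 +i* complex.Im (D 0 l)).
  apply/rowP => l; rewrite mxE.
  have /matrixP/(_ l l) : (diag_mx D)^t* = - diag_mx D.
    have e : diag_mx D = Q *m A *m Q^t*.
      by rewrite AE !mulmxA unitaryVr // mul1mx -mulmxA unitaryVr // mulmx1.
    by rewrite e !trCM trmxCK As mulNmx mulmxN mulmxA.
  rewrite !mxE eqxx !mulr1n => /(congr1 (@complex.Re R)).
  by rewrite cReJ cReN => e; apply: complex_ext => //=; lra.
exists Q, (fun l => complex.Im (D 0 l)); split; first exact: QU.
move: DE AE => {As}; set D' := \row_l _ => -> ->; exact: erefl.
Qed.

Definition cexp (y : R) : C := cos y +i* sin y.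

Lemma cexp0 : cexp 0 = 1.
Proof. by rewrite /cexp cos0 sin0. Qed.

Lemma cexpD x y : cexp (x + y) = cexp x * cexp y.
Proof. by rewrite /cexp cosD sinD; congr (_ +i* _); ring. Qed.

Lemma cexpJ y : Num.conj (cexp y) = cexp (- y).
Proof. by rewrite /cexp cosN sinN. Qed.

Lemma cexp_sum (I : Type) (r : seq I) (f : I -> R) :
  cexp (\sum_(i <- r) f i) = \prod_(i <- r) cexp (f i).
Proof. exact: (big_morph _ cexpD cexp0). Qed.

Lemma imaginary_exp (y : R) (m : nat) :
  ((0 +i* y) : C) ^+ m =
    ((~~ odd m)%:R * (-1) ^+ m./2 * y ^+ m) +i* ((odd m)%:R * (-1) ^+ m.-1./2 * y ^+ m).
Proof.
elim: m => [|m IH]; first by rewrite !expr0 /= !mul0r !mul1r.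
rewrite exprSr IH /=; apply: complex_ext; rewrite ?cReM ?cImM /=.
- rewrite uphalf_half negbK; case om : (odd m) => /=; last by rewrite add0n; ring.
  case: m om {IH} => // m /=; rewrite uphalf_half => /negbTE ->.
  by rewrite add0n add1n !exprS; ring.
- by rewrite exprS; case om : (odd m) => /=; ring.
Qed.

Lemma cvgn_sum (I : Type) (r : seq I) (u : I -> nat -> R) (l : I -> R) :
  (forall i, u i n @[n --> \oo] --> l i) ->
  \sum_(i <- r) u i n @[n --> \oo] --> \sum_(i <- r) l i.
Proof.
move=> ul; elim: r => [|i r IH].
  by rewrite big_nil; under eq_fun do rewrite big_nil; exact: cvg_cst.
by rewrite big_cons; under eq_fun do rewrite big_cons; exact: cvgD.
Qed.

Lemma lim_series_comb (n : nat) (u v : 'I_n -> nat -> R) (a b : 'I_n -> R) :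
  (forall l, cvgn (series (u l))) -> (forall l, cvgn (series (v l))) ->
  limn (series (fun m => \sum_(l < n) (a l * u l m + b l * v l m))) =
  \sum_(l < n) (a l * limn (series (u l)) + b l * limn (series (v l))).
Proof.
move=> uC vC; apply/cvg_lim => //.
have -> : series (fun m => \sum_(l < n) (a l * u l m + b l * v l m)) =
    fun N => \sum_(l < n) (a l * series (u l) N + b l * series (v l) N).
  apply/funext => N; rewrite /series /= exchange_big /=; apply: eq_bigr => l _.
  by rewrite big_split /= -!mulr_sumr.
by apply: cvgn_sum => l; apply: cvgD; apply: cvgMl_tmp; [exact: uC|exact: vC].
Qed.

Lemma mulmx_conj n (F : pzRingType) (P Q D E : 'M[F]_n) : Q *m P = 1%:M ->
  (P *m D *m Q) *m (P *m E *m Q) = P *m (D *m E) *m Q.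
Proof. by move=> QP; rewrite !mulmxA -(mulmxA (P *m D)) QP mulmx1. Qed.

Definition spectral_exp n (Q : 'M[C]_n) (th : 'I_n -> R) (t : R) : 'M[C]_n :=
  Q^t* *m diag_mx (\row_l cexp (t * th l)) *m Q.

(** Powers of a diagonalized matrix are diagonalized, so each entry of the
    exponential series is a linear combination of cosine and sine series. All
    facts about exp used below are read off this formula. *)
Lemma expm_spectral n (Q : 'M[C]_n) (th : 'I_n -> R) (t : R) : Q \is unitarymx ->
  expm (t%:C *: (Q^t* *m diag_mx (\row_l (0 +i* th l)) *m Q)) = spectral_exp Q th t.
Proof.
move=> QU; rewrite /spectral_exp.
pose z l : C := 0 +i* (t * th l).
have pw m : (t%:C *: (Q^t* *m diag_mx (\row_l (0 +i* th l)) *m Q)) ^+ m =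
    Q^t* *m diag_mx (\row_l (z l ^+ m)) *m Q.
  elim: m => [|m IH].
    rewrite expr0 (_ : diag_mx _ = 1%:M) ?mulmx1 ?unitaryVl //.
    by apply/matrixP => i j; rewrite !mxE expr0.
  rewrite exprSr IH -[_ * _]/(_ *m _) -scalemxAr (mulmx_conj _ _ (unitaryVr QU)).
  rewrite mulmx_diag scalemxAl scalemxAr -linearZ /=.
  suff -> : (t%:C *: \row_j ((\row_l z l ^+ m) 0 j * (\row_l (0 +i* th l)) 0 j))
    = \row_l z l ^+ m.+1 by [].
  apply/rowP => l; rewrite !mxE exprSr mulrCA; congr (_ * _).
  by apply: complex_ext; rewrite /z ?cReZ ?cImZ /= ?mulr0.
pose c i j l : C := Num.conj (Q l i) * Q l j.
have entry (d : 'I_n -> C) i j : (Q^t* *m diag_mx (\row_l d l) *m Q) i j =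
    \sum_l c i j l * d l.
  by rewrite mxE; apply: eq_bigr => l _; rewrite mul_mx_diag !mxE mulrAC.
clearbody c; apply/matrixP => i j; rewrite entry mxE.
apply: complex_ext; rewrite ?cRe_sum ?cIm_sum /=.
- under eq_fun do rewrite pw entry cRe_sum mulr_suml.
  rewrite (_ : (fun m => _) = fun m => \sum_l
     (complex.Re (c i j l) * cos_coeff (t * th l) m +
      - complex.Im (c i j l) * sin_coeff (t * th l) m)).
    rewrite lim_series_comb; last 2 first.
    + by move=> l; exact: is_cvg_series_cos_coeff.
    + by move=> l; exact: is_cvg_series_sin_coeff.
    by apply: eq_bigr => l _; rewrite cReM /cexp /= cos.unlock sin.unlock mulNr.
  apply/funext => m; apply: eq_bigr => l _.
  by rewrite cReM /z imaginary_exp cos_coeffE sin_coeffE /=; ring.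
- under eq_fun do rewrite pw entry cIm_sum mulr_suml.
  rewrite (_ : (fun m => _) = fun m => \sum_l
     (complex.Im (c i j l) * cos_coeff (t * th l) m +
      complex.Re (c i j l) * sin_coeff (t * th l) m)).
    rewrite lim_series_comb; last 2 first.
    + by move=> l; exact: is_cvg_series_cos_coeff.
    + by move=> l; exact: is_cvg_series_sin_coeff.
    by apply: eq_bigr => l _; rewrite cImM /cexp /= cos.unlock sin.unlock addrC.
  apply/funext => m; apply: eq_bigr => l _.
  by rewrite cImM /z imaginary_exp cos_coeffE sin_coeffE /=; ring.
Qed.

Lemma spectral_exp0 n (Q : 'M[C]_n) th : Q \is unitarymx ->
  spectral_exp Q th 0 = 1%:M.
Proof.
move=> QU; rewrite /spectral_exp (_ : diag_mx _ = 1%:M) ?mulmx1 ?unitaryVl //.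
by apply/matrixP => i j; rewrite !mxE mul0r cexp0.
Qed.

Lemma spectral_expD n (Q : 'M[C]_n) th s t : Q \is unitarymx ->
  spectral_exp Q th (s + t) = spectral_exp Q th s *m spectral_exp Q th t.
Proof.
move=> QU; rewrite /spectral_exp (mulmx_conj _ _ (unitaryVr QU)) mulmx_diag.
set d := \row_j (_ * _); suff -> : \row_l cexp ((s + t) * th l) = d by [].
by apply/rowP => l; rewrite !mxE mulrDl cexpD.
Qed.

Lemma spectral_exp_trC n (Q : 'M[C]_n) th t :
  (spectral_exp Q th t)^t* = spectral_exp Q th (- t).
Proof.
rewrite /spectral_exp !trCM trmxCK mulmxA.
suff -> : (diag_mx (\row_l cexp (t * th l)))^t* = diag_mx (\row_l cexp (- t * th l)) by [].
apply/matrixP => i j; rewrite !mxE eq_sym.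
by case: eqP => [->|_]; rewrite ?mulr1n ?cexpJ ?mulNr // !mulr0n rmorph0.
Qed.

Lemma sum_spectral_trace n (Q : 'M[C]_n) (th : 'I_n -> R) : Q \is unitarymx ->
  \tr (Q^t* *m diag_mx (\row_l (0 +i* th l)) *m Q) = 0 -> \sum_l th l = 0.
Proof.
move=> QU; rewrite -mulmxA mxtrace_mulC -mulmxA unitaryVr // mulmx1.
move=> /(congr1 (@complex.Im R)); rewrite /mxtrace cIm_sum => tr0.
by rewrite -[RHS]tr0; apply: eq_bigr => l _; rewrite !mxE eqxx.
Qed.

Section Group.
Variables (n : nat) (A : 'M[C]_n).
Hypothesis As : A^t* = - A.

Lemma expm0 : expm ((0:R)%:C *: A) = 1%:M.
Proof.
have [Q [th [QU ->]]] := skew_spectral As.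
by rewrite (expm_spectral _ _ QU) spectral_exp0.
Qed.

Lemma expmD (s t : R) : expm ((s + t)%:C *: A) = expm (s%:C *: A) *m expm (t%:C *: A).
Proof.
have [Q [th [QU ->]]] := skew_spectral As.
by rewrite !(expm_spectral _ _ QU) spectral_expD.
Qed.

Lemma expm_trC (t : R) : (expm (t%:C *: A))^t* = expm ((- t)%:C *: A).
Proof.
have [Q [th [QU ->]]] := skew_spectral As.
by rewrite !(expm_spectral _ _ QU) spectral_exp_trC.
Qed.

Lemma expm_unitary (t : R) : expm (t%:C *: A) \is unitarymx.
Proof. by apply/unitarymxP; rewrite expm_trC -expmD subrr expm0. Qed.

Lemma det_expm (t : R) : \tr A = 0 -> \det (expm (t%:C *: A)) = 1.
Proof.
have [Q [th [QU ->]]] := skew_spectral As.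
rewrite (expm_spectral _ _ QU) => /(sum_spectral_trace QU) th0.
rewrite /spectral_exp det_mulmx det_mulmx mulrC mulrA -det_mulmx unitaryVr // det1.
rewrite mul1r det_diag; under eq_bigr do rewrite mxE.
by rewrite -cexp_sum -mulr_sumr th0 mulr0 cexp0.
Qed.

Lemma expm_comm (t : R) : A *m expm (t%:C *: A) = expm (t%:C *: A) *m A.
Proof.
have [Q [th [QU ->]]] := skew_spectral As.
rewrite (expm_spectral _ _ QU); apply: etrans (mulmx_conj _ _ (unitaryVr QU)) _.
apply: etrans _ (esym (mulmx_conj _ _ (unitaryVr QU))).
by rewrite diag_mxC.
Qed.

(** With the exponential diagonalized, only the scalar functions cos and sin
    are differentiated. *)
Lemma is_mxderive_expm (t : R) :
  is_mxderive (V := R^o) t 1 (fun s : R^o => expm (s%:C *: A)) (A *m expm (t%:C *: A)).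
Proof.
have [Q [th [QU ->]]] := skew_spectral As.
under [X in is_mxderive _ _ X]funext do rewrite (expm_spectral _ _ QU).
rewrite (expm_spectral _ _ QU) /spectral_exp (mulmx_conj _ _ (unitaryVr QU)).
apply: is_mxderiveMr; apply: is_mxderiveMl => i j.
rewrite mulmx_diag mxE mxE.
rewrite (_ : (fun _ => _) = fun s : R^o => cexp (s * th i) *+ (i == j)); last first.
  by apply/funext => s; rewrite !mxE.
case: (i == j); last by rewrite !mulr0n; exact: is_cderive_cst.
rewrite !mulr1n !mxE /cexp; split.
- rewrite cReM /= mul0r sub0r.
  have dl : is_derive (t : R^o) 1 (fun s : R^o => s * th i) (th i).
    have -> : (fun s : R^o => s * th i) = (th i) *: (id : R^o -> R^o).
      by apply/funext => s; rewrite mulrC.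
    by apply: is_derive_eq; rewrite /GRing.scale /= mulr1.
  apply: DeriveDef.
    apply/derivable1_diffP; apply: differentiable_comp; apply/derivable1_diffP.
      by have [] := dl.
    exact: derivable_cos.
  rewrite -derive1E (derive1_comp (f := fun s => s * th i) (g := cos)) //.
  by rewrite !derive1E !derive_val; ring.
- rewrite cImM /= mul0r add0r.
  have dl : is_derive (t : R^o) 1 (fun s : R^o => s * th i) (th i).
    have -> : (fun s : R^o => s * th i) = (th i) *: (id : R^o -> R^o).
      by apply/funext => s; rewrite mulrC.
    by apply: is_derive_eq; rewrite /GRing.scale /= mulr1.
  apply: DeriveDef.
    apply/derivable1_diffP; apply: differentiable_comp; apply/derivable1_diffP.
      by have [] := dl.
    exact: derivable_sin.
  rewrite -derive1E (derive1_comp (f := fun s => s * th i) (g := sin)) //.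
  by rewrite !derive1E !derive_val; ring.
Qed.

(** Precomposition with a continuous linear form l covers both a one-parameter
    group on R and its pullback along a coordinate of R^d. *)
Lemma smooth_expm (V : normedModType R) (l : V -> R) : (forall x, is_diff x l l) ->
  smooth_mx setT (fun x => expm ((l x)%:C *: A)).
Proof.
move=> lD; have [Q [th [QU ->]]] := skew_spectral As.
under [X in smooth_mx _ X]funext do rewrite (expm_spectral _ _ QU).
apply: smooth_mxM; last exact: smooth_mx_cst.
apply: smooth_mxM; first exact: smooth_mx_cst.
move=> i j.
have [c s] := smooth_cos_sin (th i) lD.
split.
- rewrite (_ : (fun _ => _) = fun x => cos (l x * th i) * (i == j)%:R).
    by apply: smoothM => //; exact: smooth_cst.
  by apply/funext => x; rewrite !mxE; case: (i == j); rewrite ?mulr1 ?mulr0.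
- rewrite (_ : (fun _ => _) = fun x => sin (l x * th i) * (i == j)%:R).
    by apply: smoothM => //; exact: smooth_cst.
  by apply/funext => x; rewrite !mxE; case: (i == j); rewrite ?mulr1 ?mulr0.
Qed.

End Group.
End SkewHermitianExponential.

(** * Commutators and blocks *)

Section BlockAlgebra.
Variables (F : comNzRingType) (n : nat) (K : finType) (blk : 'I_n -> K).
Implicit Types (A B Z : 'M[F]_n) (w : K -> K -> F).

Definition off_block A : 'M[F]_n :=
  \matrix_(a, b) (if blk a == blk b then 0 else A a b).
Definition weight w A : 'M[F]_n := \matrix_(a, b) (w (blk a) (blk b) * A a b).
(** The linear condition defining m; block_diag below is the one defining k. *)
Definition zero_diag A := forall a b, blk a = blk b -> A a b = 0.
Definition block_diag Z := forall a b, blk a != blk b -> Z a b = 0.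
(** The same function as adm, over an arbitrary commutative ring. Matrix
    identities are proved at this generality. *)
Definition lie A B := A *m B - B *m A.

Lemma off_block_id A : zero_diag A -> off_block A = A.
Proof.
by move=> Az; apply/matrixP => a b; rewrite mxE; case: eqP => // /Az ->.
Qed.

Lemma zero_diag_off_block A : zero_diag (off_block A).
Proof. by move=> a b /eqP e; rewrite mxE e. Qed.

Lemma off_block_eq A B : block_diag (A - B) -> off_block A = off_block B.
Proof.
move=> D; apply/matrixP => a b; rewrite !mxE; case: eqP => // /eqP /D /eqP.
by rewrite !mxE subr_eq0 => /eqP.
Qed.

Lemma off_blockD A B : off_block (A + B) = off_block A + off_block B.
Proof. by apply/matrixP => a b; rewrite !mxE; case: eqP; rewrite ?addr0. Qed.

Lemma off_blockB A B : off_block (A - B) = off_block A - off_block B.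
Proof. by apply/matrixP => a b; rewrite !mxE; case: eqP; rewrite ?subr0. Qed.

Lemma off_blockZ c A : off_block (c *: A) = c *: off_block A.
Proof. by apply/matrixP => a b; rewrite !mxE; case: eqP; rewrite ?mulr0. Qed.

Lemma off_block_sum (I : Type) (r : seq I) (f : I -> 'M[F]_n) :
  off_block (\sum_(i <- r) f i) = \sum_(i <- r) off_block (f i).
Proof.
elim: r => [|i r IH]; last by rewrite !big_cons off_blockD IH.
by rewrite !big_nil; apply/matrixP => a b; rewrite !mxE; case: eqP.
Qed.

Lemma zero_diag_weight w A : zero_diag A -> zero_diag (weight w A).
Proof. by move=> Az a b e; rewrite mxE Az // mulr0. Qed.

Lemma zero_diag_mulr A Z : zero_diag A -> block_diag Z -> zero_diag (A *m Z).
Proof.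
move=> Az Zd a b e; rewrite mxE big1 // => c _.
case: (blk c =P blk b) => [e'|/eqP ne]; first by rewrite Az ?mul0r // e'.
by rewrite [X in _ * X]Zd ?mulr0.
Qed.

Lemma zero_diag_mull A Z : zero_diag A -> block_diag Z -> zero_diag (Z *m A).
Proof.
move=> Az Zd a b e; rewrite mxE big1 // => c _.
case: (blk a =P blk c) => [e'|/eqP ne]; last by rewrite Zd ?mul0r.
by rewrite [X in _ * X]Az ?mulr0 // -e'.
Qed.

Lemma weight_mulr w A Z : block_diag Z -> weight w (A *m Z) = weight w A *m Z.
Proof.
move=> Zd; apply/matrixP => a b; rewrite !mxE mulr_sumr; apply: eq_bigr => c _.
rewrite !mxE mulrA; case: (blk c =P blk b) => [->//|/eqP /Zd ->].
by rewrite !mulr0.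
Qed.

Lemma weight_mull w A Z : block_diag Z -> weight w (Z *m A) = Z *m weight w A.
Proof.
move=> Zd; apply/matrixP => a b; rewrite !mxE mulr_sumr; apply: eq_bigr => c _.
rewrite !mxE mulrCA; case: (blk a =P blk c) => [->//|/eqP /Zd ->].
by rewrite !mul0r.
Qed.

Lemma weightB w A B : weight w (A - B) = weight w A - weight w B.
Proof. by apply/matrixP => a b; rewrite !mxE mulrBr. Qed.

Lemma weightD w A B : weight w (A + B) = weight w A + weight w B.
Proof. by apply/matrixP => a b; rewrite !mxE mulrDr. Qed.

Lemma weightZ w c A : weight w (c *: A) = c *: weight w A.
Proof. by apply/matrixP => a b; rewrite !mxE mulrCA. Qed.

(** The operator of a metric acts by a scalar on each block, so it commutes
    with ad of a block-diagonal matrix. *)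
Lemma weight_lie w A Z : block_diag Z -> weight w (lie A Z) = lie (weight w A) Z.
Proof. by move=> Zd; rewrite /lie weightB weight_mulr // weight_mull. Qed.

Lemma zero_diag_lie A Z : zero_diag A -> block_diag Z -> zero_diag (lie A Z).
Proof.
move=> Az Zd a b e; rewrite !mxE.
have := zero_diag_mulr Az Zd e; have := zero_diag_mull Az Zd e.
by rewrite !mxE => -> ->; rewrite subr0.
Qed.

Definition sym_weight w := forall i j, i != j -> w i j = w j i.

Lemma tr_weight_sym w A B : sym_weight w -> zero_diag B ->
  \tr (weight w A *m B) = \tr (A *m weight w B).
Proof.
move=> ws Bz; apply: eq_bigr => a _; rewrite !mxE; apply: eq_bigr => b _.
rewrite !mxE mulrCA mulrA; case: (blk a =P blk b) => [e|/eqP ne].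
  by rewrite Bz ?mulr0.
by rewrite ws.
Qed.

Lemma tr_off_block A B : zero_diag B -> \tr (off_block A *m B) = \tr (A *m B).
Proof.
move=> Bz; apply: eq_bigr => a _; rewrite !mxE; apply: eq_bigr => b _.
by rewrite mxE; case: eqP => // e; rewrite Bz ?mulr0.
Qed.

(** On a diagonal block the two products have the same terms, by symmetry of
    the weights: [u, L u] is in m. *)
Lemma zero_diag_lie_weight w A : sym_weight w -> zero_diag A ->
  zero_diag (lie A (weight w A)).
Proof.
move=> ws Az a b e; rewrite !mxE -sumrB big1 // => c _; rewrite !mxE.
case: (blk a =P blk c) => [e'|/eqP ne].
  by rewrite (Az a c e') !mul0r ?mulr0 ?mul0r subrr.
by rewrite -e -ws // mulrCA -mulrA subrr.
Qed.

Lemma tr_lie A B C : \tr (lie A B *m C) = \tr (A *m lie B C).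
Proof.
rewrite /lie mulmxBl mulmxBr !mulmxA [LHS]raddfB [RHS]raddfB /=; congr (_ - _).
by rewrite -(mulmxA B A C) (mxtrace_mulC B).
Qed.

(** Moving L across the trace and using ad-invariance, the contributions of Z
    cancel and only [u, L u] is left. This is the variation of the energy of a
    curve with velocity u in the direction omega, for a lift with velocity u +
    Z. *)
Lemma euler_arnold_trace w (u Z omega : 'M[F]_n) :
  sym_weight w -> zero_diag u -> block_diag Z ->
  \tr (weight w (off_block omega) *m lie u (u + Z))
  + \tr (weight w (off_block (lie omega (u + Z))) *m u)
  = \tr (off_block omega *m lie u (weight w u)).
Proof.
move=> ws uz Zd.
have -> : lie u (u + Z) = lie u Z.
  by rewrite /lie mulmxDr mulmxDl opprD addrACA subrr add0r.
have lz := zero_diag_lie uz Zd.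
rewrite tr_weight_sym // weight_lie // tr_off_block; last first.
  by apply: zero_diag_lie => //; exact: zero_diag_weight.
rewrite tr_weight_sym // tr_off_block; last exact: zero_diag_weight.
rewrite tr_off_block; last exact: zero_diag_lie_weight.
rewrite tr_lie -linearD -mulmxDr /=; congr (\tr (_ *m _)).
rewrite /lie mulmxDl mulmxDr; set L := weight w u.
have -> : u *m L + Z *m L - (L *m u + L *m Z) =
    (u *m L - L *m u) - (L *m Z - Z *m L) by rewrite opprD addrACA opprB.
by rewrite addrC subrK.
Qed.

End BlockAlgebra.

(** * The Killing form as a trace form *)

Section KillingTrace.
Variables (F : comNzRingType) (n : nat).

Lemma lie_is_linear (X : 'M[F]_n) : linear (lie X).
Proof.
move=> c A B; rewrite /lie mulmxDr mulmxDl -scalemxAr -scalemxAl scalerBr.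
by rewrite opprD addrACA.
Qed.

HB.instance Definition _ (X : 'M[F]_n) :=
  GRing.isLinear.Build F _ _ *:%R (lie X) (lie_is_linear X).

Lemma mul_delta_mulE (P Q : 'M[F]_n) i j :
  (P *m delta_mx i j *m Q) i j = P i i * Q j j.
Proof.
rewrite -(mul_delta_mx (0 : 'I_1)) mulmxA -colE -mulmxA -rowE mxE big_ord1.
by rewrite !mxE.
Qed.

(** Trace of ad X ad Y on gl_n, by summing over matrix units. *)
Lemma tr_lin_mx_lie (X Y : 'M[F]_n) :
  \tr (lin_mx (lie X) *m lin_mx (lie Y)) =
  (\tr (X *m Y)) *+ n *+ 2 - (\tr X * \tr Y) *+ 2.
Proof.
have S (f : 'I_(n * n) -> F) : \sum_a f a = \sum_i \sum_j f (mxvec_index i j).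
  rewrite pair_bigA /= (reindex _ (curry_mxvec_bij _ _)) /=.
  by apply: eq_big => [[i j]|[i j] _].
rewrite /mxtrace S.
have E i j : (lin_mx (lie X) *m lin_mx (lie Y)) (mxvec_index i j) (mxvec_index i j) =
   (Y *m X) i i * 1 - Y i i * X j j - X i i * Y j j + 1 * (X *m Y) j j.
  have -> : forall M : 'M[F]_(n * n), M (mxvec_index i j) (mxvec_index i j) =
      (row (mxvec_index i j) M) 0 (mxvec_index i j) by move=> M; rewrite mxE.
  rewrite row_mul rowE -mxvec_delta !mul_vec_lin mxvecE /=; set D := delta_mx i j.
  have -> : lie Y (lie X D) = (Y *m X) *m D *m 1%:M - Y *m D *m X
       - X *m D *m Y + 1%:M *m D *m (X *m Y).
    by rewrite /lie mulmxBr mulmxBl mulmx1 mul1mx !mulmxA opprB addrA addrAC.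
  have m (P Q : 'M[F]_n) : (P *m D *m Q) i j = P i i * Q j j := mul_delta_mulE P Q i j.
  have d l : (1%:M : 'M[F]_n) l l = 1 by rewrite mxE eqxx.
  have mD (P Q : 'M[F]_n) : (P + Q) i j = P i j + Q i j by rewrite mxE.
  have mN (P : 'M[F]_n) : (- P) i j = - P i j by rewrite mxE.
  by rewrite !mD !mN !m !d.
under eq_bigr do under eq_bigr do rewrite E mulr1 mul1r.
have c (x : F) : \sum_(i < n) x = x *+ n by rewrite sumr_const card_ord.
under eq_bigr do rewrite big_split !sumrB /= c -!mulr_sumr.
rewrite big_split !sumrB /= c -!mulr_suml sumrMnl -!/(mxtrace _) (mxtrace_mulC Y).
rewrite (mulrC (\tr Y)) !mulr2n opprD addrAC -addrA -[in LHS]addrA addrCA.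
by rewrite [LHS]addrC !addrA.
Qed.

End KillingTrace.

(** * Invariant metrics and the bracket condition *)

Section Flags.
Context {R : realType} {k : nat} {p_ : 'I_k -> nat}.
Local Notation C := R[i].
Local Notation n := (\sum_i p_ i)%N.
Local Notation M := ('M[C]_n).
Local Notation blk := (@tagnat.sig1 k p_).
Implicit Types (A X Y Z : M) (lam : 'I_k -> 'I_k -> R).

Lemma proj_mE A : proj_m A = off_block blk A.
Proof.
apply/matrixP => a b; rewrite !mxE; case: eqP => _; rewrite mxE //.
by rewrite !tagnat.sig2K.
Qed.

Lemma LambdaE lam A : Lambda lam A = weight blk (fun i j => (lam i j)%:C) A.
Proof. by apply/matrixP => a b; rewrite !mxE !tagnat.sig2K. Qed.

Lemma submxblock_eq0P A i j :
  submxblock A i j = 0 <-> forall a b, blk a = i -> blk b = j -> A a b = 0.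
Proof.
split=> [/matrixP A0 a b ai bj|A0]; last first.
  by apply/matrixP => s t; rewrite !mxE A0 // tagnat.Rank1K.
subst i j; have := A0 (tagnat.sig2 a) (tagnat.sig2 b).
by rewrite !mxE !tagnat.sig2K.
Qed.

Lemma mspaceP A : mspace A <-> A^t* = - A /\ zero_diag blk A.
Proof.
split=> -[As A0]; split=> //; last first.
  by move=> i; apply/submxblock_eq0P => a b ai bi; apply: A0; rewrite ai bi.
by move=> a b e; have /submxblock_eq0P/(_ a b) := A0 (blk a); exact.
Qed.

Lemma SKP Z : SK Z <-> SU Z /\ block_diag blk Z.
Proof.
split=> -[ZU Z0]; split=> //.
  by move=> a b ne; have /submxblock_eq0P/(_ a b) := Z0 _ _ ne; exact.
by move=> i j ne; apply/submxblock_eq0P => a b ai bj; apply: Z0; rewrite ai bj.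
Qed.

Lemma submxblock_mulP A i j m :
  submxblock A i j *m submxblock A j m = 0 <->
  forall a b, blk a = i -> blk b = m -> \sum_(c | blk c == j) A a c * A c b = 0.
Proof.
pose B : M := \matrix_(a, b) (if blk a == j then A a b else 0).
have -> : submxblock A i j *m submxblock A j m = submxblock (A *m B) i m.
  rewrite -[in RHS](submxblockK A) -[in RHS](submxblockK B) mul_mxblock mxblockK.
  rewrite (bigD1 j) //= big1 ?addr0.
    by congr (_ *m _); apply/matrixP => s t; rewrite !mxE tagnat.Rank1K eqxx.
  move=> l /negbTE lj; rewrite (_ : submxblock B l m = 0) ?mulmx0 //.
  by apply/matrixP => s t; rewrite !mxE tagnat.Rank1K lj.
rewrite submxblock_eq0P; split=> H a b ai bm; rewrite -[RHS](H a b ai bm) mxE.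
  by rewrite big_mkcond; apply: eq_bigr => c _; rewrite mxE; case: eqP; rewrite ?mulr0.
by rewrite [RHS]big_mkcond; apply: eq_bigr => c _; rewrite mxE; case: eqP; rewrite ?mulr0.
Qed.

Lemma tr_zero_diag A : zero_diag blk A -> \tr A = 0.
Proof. by move=> A0; apply: big1 => a _; exact: A0. Qed.

(** The second factor has trace zero, so the term tr X tr Y of the Killing
    form vanishes. *)
Lemma metric_oE lam X Y : zero_diag blk Y ->
  metric_o lam X Y =
  - (complex.Re (\tr (weight blk (fun i j => (lam i j)%:C) X *m Y))) *+ n *+ 2.
Proof.
move=> Y0; rewrite /metric_o /killing LambdaE.
rewrite -[adm _]/(lie _) -[adm Y]/(lie Y) tr_lin_mx_lie (tr_zero_diag Y0) mulr0.
rewrite mul0rn subr0 -!mulrnA; set z := mxtrace _.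
have cReMn (x : C) m : complex.Re (x *+ m) = complex.Re x *+ m.
  by elim: m => [|m IH]; rewrite ?mulr0n // !mulrS cReD IH.
by rewrite cReMn mulNrn.
Qed.

Lemma sym_weight_is_lambda lam : is_lambda lam ->
  sym_weight (fun i j : 'I_k => (lam i j)%:C).
Proof. by move=> lamP i j ne; have [_ ->] := lamP i j ne. Qed.

Lemma skew_entry A a b : A^t* = - A -> A b a = - Num.conj (A a b).
Proof. by move=> /matrixP/(_ b a); rewrite !mxE => ->; rewrite opprK. Qed.

Lemma tr_weight_skew lam X : X^t* = - X ->
  complex.Re (\tr (weight blk (fun i j => (lam i j)%:C) X *m X)) =
  - \sum_a \sum_b lam (blk a) (blk b) *
       (complex.Re (X a b) ^+ 2 + complex.Im (X a b) ^+ 2).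
Proof.
move=> Xs; rewrite cRe_sum -sumrN; apply: eq_bigr => a _.
rewrite mxE cRe_sum -sumrN; apply: eq_bigr => b _.
rewrite mxE (skew_entry b a Xs) -mulrA cReZ cReM cReN cImN cReJ cImJ; ring.
Qed.

(** For a skew-Hermitian X the metric is a sum of terms lambda |x_ab|^2 with
    lambda > 0. *)
Lemma metric_o_eq0 lam X : is_lambda lam -> mspace X -> metric_o lam X X = 0 -> X = 0.
Proof.
move=> lamP /mspaceP[Xs X0]; rewrite metric_oE // tr_weight_skew // opprK => /eqP.
have h0 a b : 0 <= lam (blk a) (blk b) *
       (complex.Re (X a b) ^+ 2 + complex.Im (X a b) ^+ 2).
  case: (blk a =P blk b) => [e|/eqP ne].
    by rewrite X0 //= expr0n /= addr0 mulr0.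
  have [l0 _] := lamP _ _ ne.
  by apply: mulr_ge0; [exact: ltW | apply: addr_ge0; exact: sqr_ge0].
rewrite -mulrnA => S0; apply/matrixP => a b; rewrite mxE.
have ng : (0 < n * 2)%N by rewrite muln_gt0 andbT; exact: leq_ltn_trans (ltn_ord a).
move: S0; rewrite mulrn_eq0 eqn0Ngt ng /= => S0.
case: (blk a =P blk b) => [/X0 //|/eqP ne].
have : \sum_b lam (blk a) (blk b) *
     (complex.Re (X a b) ^+ 2 + complex.Im (X a b) ^+ 2) == 0.
  move: S0; rewrite psumr_eq0; last by move=> i _; apply: sumr_ge0.
  by move=> /allP/(_ a); rewrite mem_index_enum => /(_ isT).
rewrite psumr_eq0; last by move=> i _.
move=> /allP/(_ b); rewrite mem_index_enum => /(_ isT) /=.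
have [l0 _] := lamP _ _ ne.
rewrite mulf_eq0 gt_eqF //= paddr_eq0 ?sqr_ge0 // !sqrf_eq0 => /andP[/eqP r /eqP i].
by apply: complex_ext; rewrite ?r ?i.
Qed.

(** The (a, b) entry of [A, L A] is a sum over j of (lambda_jb - lambda_aj)
    times an entry of the product of blocks. The metric with weight 2 on {j,
    m} and 1 elsewhere makes the factor vanish for all other blocks. *)
Lemma lie_weight_eq0 A :
  zero_diag blk A ->
  (forall lam, is_lambda lam -> lie A (weight blk (fun i j => (lam i j)%:C) A) = 0) <->
  (forall i j m : 'I_k, i != j -> j != m -> i != m ->
     submxblock A i j *m submxblock A j m = 0).
Proof.
move=> A0.
have E lam a b : lie A (weight blk (fun i j => (lam i j)%:C) A) a b =
    \sum_j ((lam j (blk b))%:C - (lam (blk a) j)%:C) *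
       \sum_(c | blk c == j) A a c * A c b.
  rewrite !mxE -sumrB (partition_big blk predT) //=; apply: eq_bigr => j _.
  rewrite mulr_sumr; apply: eq_bigr => c /eqP cj; rewrite !mxE cj; ring.
split=> [H i j m ij jm im|H lam lamP].
  apply/submxblock_mulP => a b ai bm.
  (* The weight that separates the pair {j, m}. *)
  pose l u v : R := if (u == j) && (v == m) || (u == m) && (v == j) then 2 else 1.
  have lP : is_lambda l.
    move=> u v uv; rewrite /l; split; first by case: ifP.
    by rewrite orbC [(u == m) && _]andbC [(u == j) && _]andbC.
  have /matrixP/(_ a b) := H l lP; rewrite E ai bm mxE (bigD1 j) //= [X in _ + X]big1.
    rewrite addr0 /l !eqxx (negbTE ij) (negbTE im) /=.
    by rewrite -rmorphB /= (_ : 2 - 1 = 1 :> R) ?mul1r //; lra.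
  move=> u uj; rewrite /l (negbTE uj) (negbTE ij) (negbTE im) /= ?andbF /=.
  by rewrite [m == j]eq_sym (negbTE jm) andbF subrr mul0r.
apply/matrixP => a b; rewrite E mxE big1 // => j _.
case: (blk a =P j) => [aj|/eqP aj].
  by rewrite [X in _ * X]big1 ?mulr0 // => c /eqP cj; rewrite A0 ?mul0r // aj cj.
case: (j =P blk b) => [jb|/eqP jb].
  by rewrite [X in _ * X]big1 ?mulr0 // => c /eqP cj; rewrite [A c b]A0 ?mulr0 // -jb cj.
case: (blk a =P blk b) => [ab|/eqP ab].
  by have [_ ->] := lamP _ _ jb; rewrite ab subrr mul0r.
by have /submxblock_mulP/(_ a b erefl erefl) -> := H _ _ _ aj jb ab; rewrite mulr0.
Qed.

End Flags.

(** * Cosets and lifts *)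

Section Cosets.
Context {R : realType} {k : nat} {p_ : 'I_k -> nat}.
Local Notation C := R[i].
Local Notation n := (\sum_i p_ i)%N.
Local Notation M := ('M[C]_n).
Local Notation blk := (@tagnat.sig1 k p_).
Implicit Types (A X Y Z g : M).

Lemma SU1 : SU (1%:M : M).
Proof.
split; last exact: det1.
by apply/unitarymxP; rewrite trmx1 map_mx1 mulmx1.
Qed.

Lemma SUM g g' : SU g -> SU g' -> SU (g *m g').
Proof.
move=> [gU gd] [gU' gd']; split; last by rewrite det_mulmx gd gd' mul1r.
exact: mul_unitarymx.
Qed.

Lemma SUV g : SU g -> SU (g^t*).
Proof.
move=> [gU gd]; split; first exact: unitary_conj.
by rewrite det_map_mx det_tr gd rmorph1.
Qed.

Lemma block_diagM A B : block_diag blk A -> block_diag blk B -> block_diag blk (A *m B).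
Proof.
move=> Ad Bd a b ne; rewrite mxE big1 // => c _.
case: (blk a =P blk c) => [e|/eqP ne']; last by rewrite Ad // mul0r.
by rewrite [X in _ * X]Bd ?mulr0 // -e.
Qed.

Lemma block_diagV A : block_diag blk A -> block_diag blk (A^t*).
Proof. by move=> Ad a b ne; rewrite !mxE Ad ?rmorph0 // eq_sym. Qed.

Lemma block_diag1 : block_diag blk (1%:M : M).
Proof. by move=> a b ne; rewrite mxE; case: (a =P b) ne => [->|//]; rewrite eqxx. Qed.

(** Distinct labels on distinct blocks: commuting with this one matrix is
    being block diagonal, so that conjugates of it separate the cosets. *)
Definition block_label : M := diag_mx (\row_p (val (blk p))%:R).

Lemma block_label_commuteP Z : block_diag blk Z <-> Z *m block_label = block_label *m Z.
Proof.
split=> [Zd|ZD a b ne].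
  apply/matrixP => a b; rewrite mul_mx_diag mul_diag_mx !mxE.
  by case: (blk a =P blk b) => [->|/eqP/Zd ->]; rewrite ?mul0r ?mulr0 // mulrC.
have /matrixP/(_ a b) := ZD; rewrite mul_mx_diag mul_diag_mx !mxE mulrC => /eqP.
rewrite -subr_eq0 -mulrBl mulf_eq0 subr_eq0 eqr_nat val_eqE eq_sym (negbTE ne) /=.
by move/eqP.
Qed.

Lemma SK1 : SK (1%:M : M).
Proof. by apply/SKP; split; [exact: SU1|exact: block_diag1]. Qed.

Lemma SKM g g' : SK g -> SK g' -> SK (g *m g').
Proof.
move=> /SKP[gU gd] /SKP[gU' gd']; apply/SKP.
by split; [exact: SUM|exact: block_diagM].
Qed.

Lemma SKV g : SK g -> SK (g^t*).
Proof.
by move=> /SKP[gU gd]; apply/SKP; split; [exact: SUV|exact: block_diagV].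
Qed.

Lemma SU_mulVK g A : SU g -> g *m (g^t* *m A) = A.
Proof. by move=> [gU _]; rewrite mulmxA unitaryVr // mul1mx. Qed.

Lemma SU_mulKV g A : SU g -> g^t* *m (g *m A) = A.
Proof. by move=> [gU _]; rewrite mulmxA unitaryVl // mul1mx. Qed.

(** g K = g' K in the model of F by sets of matrices. *)
Lemma act_origin_eqP g g' : SU g -> SU g' ->
  act g origin = act g' origin <-> SK (g^t* *m g').
Proof.
move=> gS gS'; split=> [E|Sk].
  have : act g' origin g' by exists 1%:M; [exact: SK1|exact: mulmx1].
  by rewrite -E => -[x xK <-]; rewrite SU_mulKV.
apply/seteqP; split=> y [x xK <-]; last first.
  exists (g^t* *m g' *m x); first exact: SKM.
  by rewrite -mulmxA SU_mulVK.
exists ((g^t* *m g')^t* *m x); first by apply: SKM => //; exact: SKV.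
by rewrite trCM trmxCK -mulmxA SU_mulVK.
Qed.

Lemma act_mul g g' (q : set M) : act g (act g' q) = act (g *m g') q.
Proof.
apply/seteqP; split=> [y [_ [x xK <-] <-]|y [x xK <-]].
  by exists x => //; rewrite mulmxA.
by exists (g' *m x); [exists x|rewrite mulmxA].
Qed.

Lemma mspace_SU_expm A (t : R) : mspace A -> SU (expm (t%:C *: A)).
Proof.
move=> /mspaceP[As A0]; split; first exact: expm_unitary.
by apply: det_expm => //; exact: tr_zero_diag A0.
Qed.

Section MaurerCartan.
Context {V : normedModType R}.
Implicit Types (h : V -> M) (x v : V).

(** Differentiate h^-1 h = 1. *)
Lemma maurer_cartan_skew h x v dh :
  (\forall y \near x, h y \is unitarymx) -> is_mxderive x v h dh ->
  ((h x)^t* *m dh)^t* = - ((h x)^t* *m dh).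
Proof.
move=> hU hD.
have D1 := is_mxderiveM (is_mxderive_trC hD) hD.
have D2 : is_mxderive x v (fun y => (h y)^t* *m h y) 0.
  apply: near_is_mxderive (is_mxderive_cst x v (1%:M : M)).
  by apply: filterS hU => y yU; rewrite unitaryVl.
have := is_mxderive_unique D1 D2.
by rewrite trCM trmxCK => /eqP; rewrite addr_eq0 => /eqP.
Qed.

Lemma block_diag_derive h x v dh :
  (\forall y \near x, block_diag blk (h y)) -> is_mxderive x v h dh ->
  block_diag blk dh.
Proof.
move=> hB hD a b ne.
have D2 : is_cderive x v (fun y => h y a b) 0.
  apply: near_is_cderive (is_cderive_cst x v 0).
  by apply: filterS hB => y yB; rewrite yB.
have [r1 i1] := hD a b; have [r2 i2] := D2.
apply: complex_ext.
  by rewrite -(@derive_val _ _ _ _ _ _ _ r1) -(@derive_val _ _ _ _ _ _ _ r2).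
by rewrite -(@derive_val _ _ _ _ _ _ _ i1) -(@derive_val _ _ _ _ _ _ _ i2).
Qed.

Lemma is_mxderive_off_block h x v dh : is_mxderive x v h dh ->
  is_mxderive x v (fun y => off_block blk (h y)) (off_block blk dh).
Proof.
move=> hD.
have E A : off_block blk A = \matrix_(a, b) ((blk a != blk b)%:R * A a b).
  by apply/matrixP => a b; rewrite !mxE; case: eqP; rewrite ?mul0r ?mul1r.
rewrite E; under [X in is_mxderive _ _ X]funext do rewrite E.
exact: is_mxderive_weight.
Qed.

End MaurerCartan.

End Cosets.

(** * The metric as a bilinear form on all matrices *)

Section MetricForm.
Context {R : realType} {k : nat} {p_ : 'I_k -> nat}.
Local Notation C := R[i].
Local Notation n := (\sum_i p_ i)%N.
Local Notation M := ('M[C]_n).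
Local Notation blk := (@tagnat.sig1 k p_).
Variable lam : 'I_k -> 'I_k -> R.
Hypothesis lamP : is_lambda lam.
Local Notation w := (fun i j : 'I_k => (lam i j)%:C).
Implicit Types (P Q : M).

Definition mform P Q : R := complex.Re (\tr (weight blk w P *m Q)).

Lemma mform_sym P Q : zero_diag blk P -> zero_diag blk Q -> mform P Q = mform Q P.
Proof.
move=> P0 Q0; rewrite /mform tr_weight_sym //; last exact: sym_weight_is_lambda.
by rewrite mxtrace_mulC.
Qed.

Lemma mformDl P P' Q : mform (P + P') Q = mform P Q + mform P' Q.
Proof. by rewrite /mform weightD mulmxDl raddfD cReD. Qed.

Lemma mformZl (c : R) P Q : mform (c%:C *: P) Q = c * mform P Q.
Proof. by rewrite /mform weightZ -scalemxAl mxtraceZ cReZ. Qed.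

Lemma mformDr P Q Q' : mform P (Q + Q') = mform P Q + mform P Q'.
Proof. by rewrite /mform mulmxDr raddfD cReD. Qed.

Lemma mformZr (c : R) P Q : mform P (c%:C *: Q) = c * mform P Q.
Proof. by rewrite /mform -scalemxAr mxtraceZ cReZ. Qed.

Lemma mformBr P Q Q' : mform P (Q - Q') = mform P Q - mform P Q'.
Proof. by rewrite /mform mulmxBr raddfB cReD cReN. Qed.

Lemma mform_sumr (I : Type) (r : seq I) P (c : I -> R) (Q : I -> M) :
  mform P (\sum_(i <- r) (c i)%:C *: Q i) = \sum_(i <- r) c i * mform P (Q i).
Proof.
elim: r => [|i r IH]; last by rewrite !big_cons mformDr mformZr IH.
by rewrite !big_nil /mform mulmx0 raddf0.
Qed.

Lemma mform_suml (I : Type) (r : seq I) Q (c : I -> R) (P : I -> M) :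
  mform (\sum_(i <- r) (c i)%:C *: P i) Q = \sum_(i <- r) c i * mform (P i) Q.
Proof.
elim: r => [|i r IH]; last by rewrite !big_cons mformDl mformZl IH.
rewrite !big_nil /mform (_ : weight blk w 0 = 0) ?mul0mx ?raddf0 //.
by apply/matrixP => a b; rewrite !mxE mulr0.
Qed.

Lemma metric_o_mform P Q : zero_diag blk Q ->
  metric_o lam P Q = - (n * 2)%:R * mform P Q.
Proof.
by move=> Q0; rewrite metric_oE // -mulrnA -[in LHS]mulr_natl mulNr -?mulrN.
Qed.

Lemma is_derive_mform (V : normedModType R) (f g : V -> M) x v df dg :
  is_mxderive x v f df -> is_mxderive x v g dg ->
  is_derive x v (fun y => mform (f y) (g y)) (mform df (g x) + mform (f x) dg).
Proof.
move=> fD gD; rewrite /mform -cReD -raddfD /=.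
by apply: is_derive_retr; apply: is_mxderiveM => //; exact: is_mxderive_weight.
Qed.

End MetricForm.

(** * The Euler-Lagrange expression of the energy *)

Section EulerLagrange.
Context {R : realType} {k : nat} {p_ : 'I_k -> nat}.
Local Notation C := R[i].
Local Notation n := (\sum_i p_ i)%N.
Local Notation M := ('M[C]_n).
Local Notation blk := (@tagnat.sig1 k p_).

Lemma addrBDr (W : zmodType) (x y z : W) : x + z - (y + z) = x - y.
Proof. by rewrite opprD addrACA subrr addr0. Qed.

Lemma symmetrized_sum d (p : 'I_d -> R) (F G K : 'I_d -> 'I_d -> R) :
  2^-1 * \sum_a \sum_b ((F b a + G b a + (F a b + G a b) - (K b a + K a b)) * p a * p b)
  = \sum_a \sum_b p a * p b * (F a b + G a b - K a b).
Proof.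
have sw : \sum_a \sum_b p a * p b * (F a b + G a b - K a b) =
          \sum_a \sum_b p a * p b * (F b a + G b a - K b a).
  rewrite exchange_big; apply: eq_bigr => a _; apply: eq_bigr => b _.
  by rewrite (mulrC (p b)).
set T := \sum_a \sum_b _ in sw *.
have -> : \sum_a \sum_b ((F b a + G b a + (F a b + G a b) - (K b a + K a b)) * p a * p b)
   = T + T.
  rewrite {2}sw /T -big_split; apply: eq_bigr => a _ /=.
  rewrite -big_split; apply: eq_bigr => b _ /=; ring.
by field.
Qed.

Lemma trC_sum (I : Type) (r : seq I) (c : I -> R) (P : I -> M) :
  (\sum_(i <- r) (c i)%:C *: P i)^t* = \sum_(i <- r) (c i)%:C *: (P i)^t*.
Proof.
elim: r => [|i r IH].
  by rewrite !big_nil; apply/matrixP => a b; rewrite !mxE rmorph0.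
rewrite !big_cons trCD IH; congr (_ + _).
by apply/matrixP => a b; rewrite !mxE rmorphM; congr (_ * _); exact: conjc_real.
Qed.

Lemma off_block_mulsum (I : Type) (r : seq I) (c : I -> R) (A : M) (P : I -> M) :
  off_block blk (A *m \sum_(i <- r) (c i)%:C *: P i) =
  \sum_(i <- r) (c i)%:C *: off_block blk (A *m P i).
Proof.
rewrite mulmx_sumr off_block_sum; apply: eq_bigr => i _.
by rewrite -scalemxAr off_blockZ.
Qed.

Variable lam : 'I_k -> 'I_k -> R.
Hypothesis lamP : is_lambda lam.
Local Notation w := (fun i j : 'I_k => (lam i j)%:C).
Local Notation B := (mform lam).

(** The Christoffel combination of the derivatives of the metric, contracted
    twice with the velocity p. S a b stands for the derivative of the frame
    vector theta a in the direction b. In the result the first term contains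
    the acceleration, and the second one only the antisymmetrized derivatives
    of the frame. *)
Lemma lagrange_contraction d (theta : 'I_d -> M) (S : 'I_d -> 'I_d -> M) (u : M)
    (p q : 'I_d -> R) (l : 'I_d) :
  (forall a, zero_diag blk (theta a)) -> (forall a b, zero_diag blk (S a b)) ->
  u = \sum_(a < d) (p a)%:C *: theta a ->
  let DG a b c := B (S a c) (theta b) + B (theta a) (S b c) in
  \sum_c B (theta l) (theta c) * q c
  + 2^-1 * \sum_a \sum_b ((DG b l a + DG a l b - DG a b l) * p a * p b)
  = B (theta l) (\sum_(a < d) (q a)%:C *: theta a +
                \sum_(a < d) (p a)%:C *: \sum_(b < d) (p b)%:C *: S a b)
    + B u (\sum_(b < d) (p b)%:C *: (S l b - S b l)).
Proof.
move=> tz Sz uE DG.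
pose F a b := B (S a b) (theta l); pose G a b := B (theta a) (S l b).
pose K a b := B (theta a) (S b l).
have -> : \sum_a \sum_b ((DG b l a + DG a l b - DG a b l) * p a * p b) =
   \sum_a \sum_b ((F b a + G b a + (F a b + G a b) - (K b a + K a b)) * p a * p b).
  apply: eq_bigr => a _; apply: eq_bigr => b _.
  by rewrite /K (mform_sym lamP (tz b) (Sz a l)).
rewrite symmetrized_sum mformDr mform_sumr -addrA; congr (_ + _).
  by apply: eq_bigr => a _; rewrite mulrC.
rewrite uE mform_suml mform_sumr -big_split; apply: eq_bigr => a _ /=.
rewrite -mulrDr !mform_sumr -big_split mulr_sumr; apply: eq_bigr => b _ /=.
by rewrite mformBr (mform_sym lamP (tz l) (Sz a b)) -mulrDr mulrA addrA.
Qed.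

Variables (d : nat) (H u : M) (h1 : 'I_d -> M) (h2 : 'I_d -> 'I_d -> M).
Variables (p q : 'I_d -> R).
Let theta a := off_block blk (H^t* *m h1 a).
Let S a b := off_block blk ((h1 b)^t* *m h1 a + H^t* *m h2 a b).
Let H1 := \sum_(a < d) (p a)%:C *: h1 a.
Let H2 := \sum_(a < d) (q a)%:C *: h1 a
          + \sum_(a < d) (p a)%:C *: \sum_(b < d) (p b)%:C *: h2 a b.
Let DG a b c := B (S a c) (theta b) + B (theta a) (S b c).

(** The antisymmetrized derivative of the frame in the directions l and x' is
    the projection of [omega_l, H^-1 H'], because the second derivatives of h
    cancel; the acceleration is the derivative of u, that is [u, H^-1 H']. *)
Lemma euler_lagrange (l : 'I_d) :
  H \is unitarymx -> (forall a b, h2 a b = h2 b a) ->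
  zero_diag blk u -> block_diag blk (H^t* *m H1 - u) ->
  (H^t* *m H1)^t* = - (H^t* *m H1) ->
  (H^t* *m h1 l)^t* = - (H^t* *m h1 l) ->
  off_block blk (H1^t* *m H1 + H^t* *m H2) = lie u (H^t* *m H1) ->
  \sum_c B (theta l) (theta c) * q c
  + 2^-1 * \sum_a \sum_b ((DG b l a + DG a l b - DG a b l) * p a * p b)
  = complex.Re (\tr (theta l *m lie u (weight blk w u))).
Proof.
move=> HU h2C u0 Zd Ws ws acc.
have tz a : zero_diag blk (theta a) by exact: zero_diag_off_block.
have Sz a b : zero_diag blk (S a b) by exact: zero_diag_off_block.
have uE : u = \sum_(a < d) (p a)%:C *: theta a.
  rewrite -off_block_mulsum -/H1 (off_block_eq Zd).
  by rewrite off_block_id.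
have accE : lie u (H^t* *m H1) = \sum_(a < d) (q a)%:C *: theta a +
     \sum_(a < d) (p a)%:C *: \sum_(b < d) (p b)%:C *: S a b.
  rewrite -acc /H2 mulmxDr addrCA off_blockD off_block_mulsum; congr (_ + _).
  rewrite off_blockD 2!off_block_mulsum -big_split /=.
  apply: eq_bigr => a _; rewrite -scalerDr; congr (_ *: _).
  rewrite off_block_mulsum /H1 trC_sum mulmx_suml off_block_sum -big_split /=.
  apply: eq_bigr => b _; rewrite /S off_blockD scalerDr; congr (_ + _).
  by rewrite -scalemxAl off_blockZ.
have LE : off_block blk (lie (H^t* *m h1 l) (H^t* *m H1)) =
     \sum_(b < d) (p b)%:C *: (S l b - S b l).
  have VK (A D : M) : (H^t* *m A)^t* *m (H^t* *m D) = A^t* *m D.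
    by rewrite trCM trmxCK -mulmxA (mulmxA H) unitaryVr // mul1mx.
  have -> : lie (H^t* *m h1 l) (H^t* *m H1) = H1^t* *m h1 l - (h1 l)^t* *m H1.
    rewrite -(VK H1 (h1 l)) -(VK (h1 l) H1) Ws ws /lie !mulNmx opprK.
    exact: addrC.
  rewrite off_blockB /H1 off_block_mulsum trC_sum mulmx_suml off_block_sum -sumrB.
  apply: eq_bigr => b _.
  have -> : S l b - S b l = off_block blk ((h1 b)^t* *m h1 l - (h1 l)^t* *m h1 b).
    rewrite /S (h2C l b) -off_blockB; congr off_block.
    exact: addrBDr.
  by rewrite -scalemxAl off_blockZ -scalerBr -off_blockB.
rewrite (lagrange_contraction q l tz Sz uE) -accE -LE.
rewrite (mform_sym lamP u0) ?/mform; last exact: zero_diag_off_block.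
rewrite -cReD; congr complex.Re.
have -> : H^t* *m H1 = u + (H^t* *m H1 - u) by rewrite addrC subrK.
by apply: euler_arnold_trace => //; exact: sym_weight_is_lambda.
Qed.

End EulerLagrange.

(** * The geodesic equation in a parametrization *)

(** Passing between the geodesic equation solved for the accelerations and its
    form with lowered index. *)
Lemma solve_linear_system (F : fieldType) d (g : 'M[F]_d) (q T : 'I_d -> F) :
  g \in unitmx ->
  (forall c, q c + \sum_l invmx g c l * T l = 0) <->
  (forall l, \sum_m g l m * q m + T l = 0).
Proof.
move=> gU.
pose qv : 'cV[F]_d := \col_c q c; pose Tv : 'cV[F]_d := \col_l T l.
have E (A B : 'M[F]_d) (y z : 'I_d -> F) c :
    (A *m (\col_i y i) + B *m (\col_i z i)) c 0 =
    \sum_m A c m * y m + \sum_m B c m * z m.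
  rewrite 3!mxE; congr (_ + _); apply: eq_bigr => m _; by rewrite mxE.
have E1 (y : 'I_d -> F) c : \sum_m (1%:M : 'M[F]_d) c m * y m = y c.
  rewrite (bigD1 c) //= mxE eqxx mul1r big1 ?addr0 // => m /negbTE mc.
  by rewrite mxE eq_sym mc mul0r.
have e1 : (forall c, q c + \sum_l invmx g c l * T l = 0) <-> qv + invmx g *m Tv = 0.
  rewrite -[qv]mul1mx; split=> [H|/matrixP H c].
    by apply/matrixP => c j; rewrite ord1 E E1 H mxE.
  by have := H c 0; rewrite E E1 mxE.
have e2 : (forall l, \sum_m g l m * q m + T l = 0) <-> g *m qv + Tv = 0.
  rewrite -[Tv]mul1mx; split=> [H|/matrixP H c].
    by apply/matrixP => c j; rewrite ord1 E E1 H mxE.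
  by have := H c 0; rewrite E E1 mxE.
rewrite e1 e2; split=> H.
  by rewrite -[Tv](mulKVmx gU) -mulmxDr H mulmx0.
by rewrite -[qv](mulKmx gU) -mulmxDr H mulmx0.
Qed.

Section GeodesicEquation.
Context {R : realType} {k : nat} {p_ : 'I_k -> nat}.
Local Notation C := R[i].
Local Notation n := (\sum_i p_ i)%N.
Local Notation M := ('M[C]_n).
Local Notation blk := (@tagnat.sig1 k p_).

Variable lam : 'I_k -> 'I_k -> R.
Hypothesis lamP : is_lambda lam.
Local Notation w := (fun i j : 'I_k => (lam i j)%:C).

Variables (d : nat) (U : set 'rV[R]_d) (h : 'rV[R]_d -> M).
Hypothesis par : parametrization U h.

Let Uo : open U. Proof. by case: par. Qed.
Let hS : smooth_mx U h. Proof. by case: par => _ []. Qed.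
Let hSU y : U y -> SU (h y).
Proof. by case: par => _ [_ H] _ _ /H[]. Qed.

Let h1 a y := derive_mx h y (delta_mx 0 a).
Let h2 a b y := derive_mx (h1 a) y (delta_mx 0 b).
Let theta a y := off_block blk ((h y)^t* *m h1 a y).
Let S a b y := off_block blk ((h1 b y)^t* *m h1 a y + (h y)^t* *m h2 a b y).

Let h1S a : smooth_mx U (h1 a).
Proof. exact: smooth_mx_derive. Qed.

Let nearU y : U y -> \forall z \near y, U z.
Proof. by move=> Uy; exact: open_nbhs_nbhs. Qed.

Let hD y v : U y -> is_mxderive y v h (derive_mx h y v).
Proof. exact: smooth_mx_is_derive. Qed.

Lemma diff_o_theta a y : diff_o h y (delta_mx 0 a) = theta a y.
Proof. by rewrite /diff_o proj_mE. Qed.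

Lemma diff_o_coord y (v : 'rV[R]_d) : U y ->
  diff_o h y v = \sum_(a < d) (v 0 a)%:C *: theta a y.
Proof.
move=> Uy; rewrite /diff_o proj_mE (derive_mx_coord v hS Uy).
exact: off_block_mulsum.
Qed.

Lemma gram_mform y a b :
  gram lam h y a b = - (n * 2)%:R * mform lam (theta a y) (theta b y).
Proof.
rewrite mxE !diff_o_theta metric_o_mform //; exact: zero_diag_off_block.
Qed.

(** The metric is definite on m and the frame is a basis of m. *)
Lemma gram_unit y : U y -> gram lam h y \in unitmx.
Proof.
move=> Uy; rewrite unitmxE unitfE; apply/det0P => -[v v0 vg].
have [_ _ _ /(_ y Uy) [homf injf _]] := par.
have inT (z : 'rV[R]_d) : z \in [set: 'rV[R]_d] by rewrite inE.
case/eqP: v0; apply: (injf _ _ (inT v) (inT 0)).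
have d0 : diff_o h y 0 = 0.
  rewrite (diff_o_coord _ Uy); apply: big1 => a _; rewrite mxE.
  exact: scale0r.
rewrite d0; apply: (metric_o_eq0 lamP); first exact: homf.
have tz : zero_diag blk (diff_o h y v) by have /mspaceP[] := homf v Logic.I.
rewrite metric_o_mform // {1}diff_o_coord // mform_suml mulr_sumr.
have q0 : (v *m gram lam h y *m v^T) 0 0 = 0 by rewrite vg mul0mx mxE.
apply: etrans _ q0; rewrite -mulmxA mxE; apply: eq_bigr => a _.
rewrite mulrCA; congr (_ * _); rewrite diff_o_coord // mform_sumr mulr_sumr mxE.
by apply: eq_bigr => b _; rewrite gram_mform mxE [RHS]mulrC mulrCA.
Qed.

Lemma theta_derive y a b : U y -> is_mxderive y (delta_mx 0 b) (theta a) (S a b y).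
Proof.
move=> Uy; apply: is_mxderive_off_block.
apply: is_mxderiveM; first exact/is_mxderive_trC/hD.
exact: smooth_mx_is_derive (h1S a) Uy.
Qed.

Lemma partial_gram y a b c : U y ->
  partial c (fun z => gram lam h z a b) y =
  - (n * 2)%:R * (mform lam (S a c y) (theta b y) + mform lam (theta a y) (S b c y)).
Proof.
move=> Uy; rewrite /partial.
have -> : (fun z => gram lam h z a b) =
    (- (n * 2)%:R : R) *: (fun z => mform lam (theta a z) (theta b z)).
  by apply/funext => z; rewrite gram_mform.
have D := is_derive_mform lam (theta_derive a c Uy) (theta_derive b c Uy).
by rewrite deriveZ ?(@derive_val _ _ _ _ _ _ _ D) //; case: D.
Qed.

Variables (X : M) (I : set R) (x : R -> 'rV[R]_d).
Hypothesis XM : mspace X.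
Hypothesis Io : open I.
Hypothesis xS : forall c, smooth (V := R^o) I (fun t => x t 0 c).
Hypothesis hx : forall t, I t ->
  U (x t) /\ act (expm (t%:C *: X)) origin = act (h (x t)) origin.

Let p a (s : R) : R := derive1 (fun s => x s 0 a) s.
Let q a (s : R) : R := derive1n 2 (fun s => x s 0 a) s.
Let H1 s := \sum_(a < d) (p a s)%:C *: h1 a (x s).
Let H2 s := \sum_(a < d) (q a s)%:C *: h1 a (x s)
   + \sum_(a < d) (p a s)%:C *: \sum_(b < d) (p b s)%:C *: h2 a b (x s).
Let u s := (h (x s))^t* *m X *m h (x s).
Let W s := (h (x s))^t* *m H1 s.

Let nearI t : I t -> \forall s \near (t : R^o), I s.
Proof. by move=> It; exact: open_nbhs_nbhs. Qed.

Let xD t a : I t -> is_derive (t : R^o) 1 (fun s : R^o => x s 0 a) (p a t).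
Proof. by move=> It; rewrite /p derive1E; exact: smooth_is_derive (xS a) It. Qed.

Let pD t a : I t -> is_derive (t : R^o) 1 (p a : R^o -> R) (q a t).
Proof.
move=> It; rewrite /q derive1nS derive1E.
rewrite (_ : p a = fun s : R^o => 'D_1 (fun s : R^o => x s 0 a) s); last first.
  by apply/funext => s; rewrite /p derive1E.
rewrite (_ : derive1n 1 _ = fun s : R^o => 'D_1 (fun s : R^o => x s 0 a) s); last first.
  by apply/funext => s; rewrite derive1n1 derive1E.
exact: (@smooth_is_derive R R^o I _ t 1 (smooth_derive (V := R^o) 1 (xS a)) It).
Qed.

Let HD t : I t -> is_mxderive (t : R^o) 1 (fun s : R^o => h (x s)) (H1 t).
Proof.
move=> It; apply: (is_mxderive_chain hS); first by have [] := hx It.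
by move=> a; exact: xD.
Qed.

Let H1D t : I t -> is_mxderive (t : R^o) 1 H1 (H2 t).
Proof.
move=> It; have [Ut _] := hx It.
rewrite /H1 /H2 -big_split; apply: is_mxderive_sum => a /=.
have pc : is_cderive (t : R^o) 1 (fun s : R^o => (p a s)%:C) ((q a t)%:C).
  by split; [exact (pD a It) | exact: is_derive_cst].
apply: (is_mxderive_scale pc).
by apply: (is_mxderive_chain (h1S a) Ut) => b; exact: xD.
Qed.

Let ucomm t : X *m expm (t%:C *: X) = expm (t%:C *: X) *m X.
Proof. by apply: expm_comm; have /mspaceP[] := XM. Qed.

Let kappa_bd t : I t -> block_diag blk ((expm (t%:C *: X))^t* *m h (x t)).
Proof.
move=> It; have [Ut E] := hx It.
have := (act_origin_eqP (mspace_SU_expm t XM) (hSU Ut)).1 E.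
by move=> /SKP[].
Qed.

Let kappa_u t : I t ->
  u t = ((expm (t%:C *: X))^t* *m h (x t))^t* *m X *m ((expm (t%:C *: X))^t* *m h (x t)).
Proof.
move=> It; rewrite /u trCM trmxCK -!mulmxA; congr (_ *m _).
by rewrite mulmxA -ucomm -mulmxA (SU_mulVK _ (mspace_SU_expm t XM)).
Qed.

(** u is the conjugate of X by exp(-tX) h(x(t)), which lies in K. *)
Lemma velocity_zero_diag t : I t -> zero_diag blk (u t).
Proof.
move=> It; rewrite kappa_u //.
apply: zero_diag_mulr (kappa_bd It).
apply: zero_diag_mull; last exact/block_diagV/kappa_bd.
by have /mspaceP[] := XM.
Qed.

(** The difference is the logarithmic derivative of exp(-tX) h(x(t)), a curve
    in K. *)
Lemma velocity_block_diag t : I t -> block_diag blk (W t - u t).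
Proof.
move=> It; have [Xs _] := (mspaceP _).1 XM.
have ED := is_mxderive_expm Xs t.
have KD := is_mxderiveM (is_mxderive_trC ED) (HD It).
have kn : \forall s \near (t : R^o), block_diag blk ((expm (s%:C *: X))^t* *m h (x s)).
  by apply: filterS (nearI It) => s; exact: kappa_bd.
have bd := block_diag_derive kn KD.
have := block_diagM (block_diagV (kappa_bd It)) bd.
rewrite trCM trmxCK mulmxDr trCM Xs mulmxN mulNmx mulmxN addrC.
have e (A : M) : (h (x t))^t* *m expm (t%:C *: X) *m ((expm (t%:C *: X))^t* *m A) =
    (h (x t))^t* *m A.
  by rewrite -mulmxA (SU_mulVK _ (mspace_SU_expm t XM)).
by rewrite e -[_ *m X *m h (x t)]mulmxA e mulmxA.
Qed.

Let unear t : I t -> \forall s \near (t : R^o), h (x s) \is unitarymx.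
Proof.
move=> It; apply: filterS (nearI It) => s Is.
by have [/hSU[]] := hx Is.
Qed.

Let W_skew t : I t -> (W t)^t* = - W t.
Proof. by move=> It; exact: maurer_cartan_skew (unear It) (HD It). Qed.

(** Both sides are the derivative of u: on the left u is the projection of
    H^-1 H', on the right it is H^-1 X H. *)
Lemma velocity_derive t : I t ->
  off_block blk ((H1 t)^t* *m H1 t + (h (x t))^t* *m H2 t) = lie (u t) (W t).
Proof.
move=> It; have [/hSU Ht _] := hx It.
have D1 : is_mxderive (t : R^o) 1 u (lie (u t) (W t)).
  have e (A : M) : A^t* *m X *m h (x t) = ((h (x t))^t* *m A)^t* *m u t.
    by rewrite trCM trmxCK /u -!mulmxA (SU_mulVK _ Ht).
  have e' : (h (x t))^t* *m X *m H1 t = u t *m W t.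
    by rewrite /u /W -!mulmxA (SU_mulVK _ Ht).
  apply: is_mxderive_eq (is_mxderiveM (is_mxderiveMr X (is_mxderive_trC (HD It))) (HD It)) _.
  by rewrite e -/(W t) (W_skew It) mulNmx e' addrC.
have D2 : is_mxderive (t : R^o) 1 u
    (off_block blk ((H1 t)^t* *m H1 t + (h (x t))^t* *m H2 t)).
  have HH1D := is_mxderiveM (is_mxderive_trC (HD It)) (H1D It).
  apply: near_is_mxderive (is_mxderive_off_block HH1D).
  apply: filterS (nearI It) => s Is.
  rewrite (off_block_eq (velocity_block_diag Is)) off_block_id //.
  exact: velocity_zero_diag.
exact: is_mxderive_unique D2 D1.
Qed.

Lemma velocity_bracket_eq0 t : I t ->
  lie X (weight blk w X) = 0 -> lie (u t) (weight blk w (u t)) = 0.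
Proof.
move=> It br0; have [/hSU Ht _] := hx It.
have := kappa_bd It; have := kappa_u It.
have : (expm (t%:C *: X))^t* *m h (x t) \is unitarymx.
  by apply: mul_unitarymx; [apply: unitary_conj; case: (mspace_SU_expm t XM)|case: Ht].
move: (_ *m h (x t)) => kap kapU -> kapB.
rewrite (weight_mulr _ _ kapB) (weight_mull _ _ (block_diagV kapB)) /lie.
rewrite !(mulmx_conj _ _ (unitaryVr kapU)).
by rewrite -mulmxBl -mulmxBr -/(lie X _) br0 mulmx0 mul0mx.
Qed.

Hypothesis n_gt0 : (0 < n)%N.

(** Lowering the index turns the geodesic equation into the Euler-Lagrange
    expressions, one for each l. *)
Lemma geodesic_equation_chart t : I t ->
  (forall c : 'I_d, q c t + \sum_(a < d) \sum_(b < d)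
      christoffel lam h c a b (x t) * p a t * p b t = 0) <->
  (forall l : 'I_d, complex.Re (\tr (theta l (x t) *m
      lie (u t) (weight blk w (u t)))) = 0).
Proof.
move=> It; have [Ut _] := hx It; have Ht := hSU Ut.
pose DG a b c := mform lam (S a c (x t)) (theta b (x t)) +
                 mform lam (theta a (x t)) (S b c (x t)).
pose c0 : R := - (n * 2)%:R.
pose T l := c0 * (2^-1 * \sum_a \sum_b ((DG b l a + DG a l b - DG a b l) * p a t * p b t)).
have PG a b c : partial c (fun z => gram lam h z a b) (x t) = c0 * DG a b c.
  exact: partial_gram Ut.
have rg (g D1 D2 D3 pa pb : R) : 2^-1 * (g * (c0 * D1 + c0 * D2 - c0 * D3)) * pa * pb =
    g * (c0 * (2^-1 * ((D1 + D2 - D3) * pa * pb))) by ring.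
have Tsum c : \sum_(a < d) \sum_(b < d) christoffel lam h c a b (x t) * p a t * p b t
    = \sum_l invmx (gram lam h (x t)) c l * T l.
  transitivity (\sum_l \sum_a \sum_b invmx (gram lam h (x t)) c l *
      (c0 * (2^-1 * ((DG b l a + DG a l b - DG a b l) * p a t * p b t)))).
    rewrite [RHS]exchange_big; apply: eq_bigr => a _ /=.
    rewrite [RHS]exchange_big; apply: eq_bigr => b _ /=.
    rewrite /christoffel mulr_sumr !mulr_suml; apply: eq_bigr => l _.
    rewrite (PG b l a) (PG a l b) (PG a b l); exact: rg.
  apply: eq_bigr => l _; rewrite /T !mulr_sumr; apply: eq_bigr => a _.
  by rewrite !mulr_sumr.
have EL l : \sum_m gram lam h (x t) l m * q m t + T l =
    c0 * complex.Re (\tr (theta l (x t) *m lie (u t) (weight blk w (u t)))).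
  have gm m : gram lam h (x t) l m * q m t =
      c0 * (mform lam (theta l (x t)) (theta m (x t)) * q m t).
    by rewrite mulrA; exact: (congr1 (fun z => z * q m t) (gram_mform (x t) l m)).
  have -> : \sum_m gram lam h (x t) l m * q m t =
      c0 * \sum_m (mform lam (theta l (x t)) (theta m (x t)) * q m t).
    by rewrite mulr_sumr; apply: eq_bigr => m _; exact: gm.
  rewrite -[LHS]mulrDr; apply: (congr1 (fun z => c0 * z)).
  apply: (@euler_lagrange _ _ _ lam lamP d (h (x t)) (u t) (h1^~ (x t))
    (fun a b => h2 a b (x t)) (p^~ t) (q^~ t) l).
  - by case: Ht.
  - by move=> a b; exact: schwarz_mx Uo Ut hS.
  - exact: velocity_zero_diag.
  - exact: velocity_block_diag.
  - exact: W_skew.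
  - apply: maurer_cartan_skew (hD _ Ut).
    by apply: filterS (nearU Ut) => y /hSU[].
  - exact: velocity_derive.
under eq_forall do rewrite Tsum.
rewrite (solve_linear_system _ _ (gram_unit Ut)).
have c00 : c0 != 0 by rewrite /c0 oppr_eq0 pnatr_eq0 muln_eq0 negb_or -lt0n n_gt0.
split=> H l; last by rewrite EL H mulr0.
by have /eqP := H l; rewrite EL mulf_eq0 (negbTE c00) /= => /eqP.
Qed.

End GeodesicEquation.

(** * A vanishing bracket gives geodesics *)

Section Sufficiency.
Context {R : realType} {k : nat} {p_ : 'I_k -> nat}.
Local Notation C := R[i].
Local Notation n := (\sum_i p_ i)%N.
Local Notation M := ('M[C]_n).
Local Notation blk := (@tagnat.sig1 k p_).

Lemma lifts_expm (X g : M) : mspace X -> SU g ->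
  lifts (V := R^o) setT (fun t : R => expm (t%:C *: X) *m g)
    (fun t => act (expm (t%:C *: X) *m g) origin).
Proof.
move=> XM gS; have [Xs _] := (mspaceP _).1 XM; split.
  apply: smooth_mxM; last exact: smooth_mx_cst.
  exact (@smooth_expm R n X Xs R^o id (fun x => is_diff_id x)).
by move=> t _; split=> //; apply: SUM gS; exact: mspace_SU_expm.
Qed.

Lemma equigeodesic_of_bracket (X : M) : (0 < n)%N -> mspace X ->
  (forall lam, is_lambda lam ->
     lie X (weight blk (fun i j => (lam i j)%:C) X) = 0) ->
  equigeodesic X.
Proof.
move=> n0 XM br lam lamP; split.
  exists (fun t : R => expm (t%:C *: X) *m 1%:M).
  have [hS hE] := lifts_expm XM (@SU1 R k p_); split=> // t tT.
  by have [? _] := hE t tT; split=> //; rewrite mulmx1.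
move=> d U h I x par Io xS hx t It.
have := geodesic_equation_chart lamP par XM Io xS hx n0 It.
move=> -[_]; apply=> l.
have b0 := velocity_bracket_eq0 par XM hx It (br _ lamP).
by rewrite b0 mulmx0 mxtrace0.
Qed.

End Sufficiency.

(** * Real coordinates on the tangent space *)

Section RealBasis.
Context {R : realType} {k : nat} {p_ : 'I_k -> nat}.
Local Notation C := R[i].
Local Notation n := (\sum_i p_ i)%N.
Local Notation M := ('M[C]_n).
Local Notation blk := (@tagnat.sig1 k p_).
Local Notation VT := ('M[R]_n * 'M[R]_n)%type.

(** Every R-linear functional on complex matrices has this shape; keeping the
    coefficients explicit makes it evident that it preserves smoothness. *)
Definition real_form (al be : 'M[R]_n) (Y : M) : R :=
  \sum_i \sum_j (complex.Re (Y i j) * al i j + complex.Im (Y i j) * be i j).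

Lemma real_formD al be Y Z : real_form al be (Y + Z) = real_form al be Y + real_form al be Z.
Proof.
rewrite /real_form -big_split; apply: eq_bigr => i _; rewrite -big_split.
by apply: eq_bigr => j _; rewrite mxE cReD cImD /=; ring.
Qed.

Lemma real_formZ al be (r : R) Y : real_form al be (r%:C *: Y) = r * real_form al be Y.
Proof.
rewrite /real_form mulr_sumr; apply: eq_bigr => i _; rewrite mulr_sumr.
by apply: eq_bigr => j _; rewrite mxE cReZ cImZ; ring.
Qed.

Lemma real_form_sum al be (I : Type) (r : seq I) (c : I -> R) (Y : I -> M) :
  real_form al be (\sum_(i <- r) (c i)%:C *: Y i) = \sum_(i <- r) c i * real_form al be (Y i).
Proof.
elim: r => [|i r IH]; last by rewrite !big_cons real_formD real_formZ IH.
rewrite !big_nil /real_form big1 // => i _; rewrite big1 // => j _.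
by rewrite mxE /= !mul0r addr0.
Qed.

Definition to_pair (Y : M) : VT :=
  (\matrix_(i, j) complex.Re (Y i j), \matrix_(i, j) complex.Im (Y i j)).
Definition of_pair (P : VT) : M := \matrix_(i, j) (P.1 i j +i* P.2 i j).

Lemma of_pairK Y : of_pair (to_pair Y) = Y.
Proof. by apply/matrixP => i j; rewrite !mxE; case: (Y i j). Qed.

Lemma to_pairK P : to_pair (of_pair P) = P.
Proof.
by case: P => P Q; congr (_, _); apply/matrixP => i j; rewrite !mxE.
Qed.

Lemma of_pair_sum (I : Type) (r : seq I) (c : I -> R) (P : I -> VT) :
  of_pair (\sum_(i <- r) c i *: P i) = \sum_(i <- r) (c i)%:C *: of_pair (P i).
Proof.
elim: r => [|i r IH].
  by rewrite !big_nil; apply/matrixP => i j; rewrite !mxE.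
rewrite !big_cons -IH; apply/matrixP => a b; rewrite !mxE.
by apply: complex_ext; rewrite ?cReD ?cImD ?cReZ ?cImZ.
Qed.

(** The kernel of this linear map is m, which presents m as a subspace of a
    finite dimensional real vector space. *)
Definition mspace_defect (P : VT) : VT * VT :=
  ((P.1 + P.1^T, P.2 - P.2^T), (P.1 - off_block blk P.1, P.2 - off_block blk P.2)).

Lemma mspace_defect_linear : linear mspace_defect.
Proof.
move=> a [P Q] [P' Q']; rewrite /mspace_defect /=.
congr ((_, _), (_, _)); apply/matrixP => i j; rewrite !mxE; try ring.
- by case: eqP => _; ring.
- by case: eqP => _; ring.
Qed.

HB.instance Definition _ :=
  GRing.isLinear.Build R VT (VT * VT)%type *:%R mspace_defect mspace_defect_linear.

Lemma mspace_defectP P : mspace (of_pair P) <-> mspace_defect P = 0.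
Proof.
rewrite mspaceP; case: P => P Q; split.
  move=> [/matrixP S D]; rewrite /mspace_defect /=.
  have e i j := S j i.
  congr ((_, _), (_, _)); apply/matrixP => i j; rewrite !mxE.
  - by have := congr1 (@complex.Re R) (e i j); rewrite !mxE cReJ /= => ->; rewrite addNr.
  - have := congr1 (@complex.Im R) (e i j); rewrite !mxE cImJ /= => /oppr_inj ->.
    by rewrite subrr.
  - case: eqP => [/D|]; rewrite ?subrr ?subr0 //.
    by move=> /(congr1 (@complex.Re R)); rewrite mxE.
  - case: eqP => [/D|]; rewrite ?subrr ?subr0 //.
    by move=> /(congr1 (@complex.Im R)); rewrite mxE.
move=> [/matrixP E1 /matrixP E2 /matrixP E3 /matrixP E4]; split.
  apply/matrixP => i j; rewrite !mxE.
  have := E1 i j; have := E2 i j; rewrite !mxE /= => /eqP; rewrite subr_eq0 => /eqP <-.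
  by move=> /eqP; rewrite addrC addr_eq0 => /eqP ->.
move=> a b e; have := E3 a b; have := E4 a b; rewrite !mxE e eqxx !subr0 /=.
by move=> -> ->.
Qed.

(** Complete A to a basis by a basis of a complement of its span. The
    functionals are the dual basis, extended to all matrices. *)
Lemma mspace_basis (A : M) : mspace A -> A != 0 ->
  exists (d : nat) (E : 'I_d.+1 -> M) (al be : 'I_d.+1 -> 'M[R]_n),
    [/\ E ord0 = A, forall a, mspace (E a),
        forall a b, real_form (al a) (be a) (E b) = (a == b)%:R &
        forall Y, mspace Y ->
          Y = \sum_a (real_form (al a) (be a) Y)%:C *: E a].
Proof.
move=> Am A0.
pose U : {vspace VT} := lker (linfun mspace_defect).
have UP P : P \in U <-> mspace (of_pair P).
  by rewrite memv_ker lfunE mspace_defectP; split=> [/eqP|/eqP].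
pose v0 := to_pair A.
have v0U : v0 \in U by apply/UP; rewrite of_pairK.
have v00 : v0 != 0.
  apply: contra A0 => /eqP e; rewrite -(of_pairK A) -/v0 e.
  by apply/eqP/matrixP => i j; rewrite !mxE.
pose W := (U :\: <[v0]>)%VS.
have UW : (<[v0]> + W)%VS = U.
  have /capv_idPr e : (<[v0]> <= U)%VS by rewrite -memvE.
  by rewrite addvC -[X in (_ + X)%VS]e addv_diff_cap.
have dW : directv (<[v0]> + W).
  by apply/directv_addP; rewrite capvC capv_diff.
pose X := [tuple of v0 :: vbasis W].
have XU : basis_of U X.
  rewrite -UW; have := cat_basis dW (seq1_basis v00) (vbasisP W).
  by [].
exists (\dim W), (fun a => of_pair X`_a),
  (fun a => \matrix_(i, j) coord X a (delta_mx i j, 0)),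
  (fun a => \matrix_(i, j) coord X a (0, delta_mx i j)).
have cE a Y : real_form (\matrix_(i, j) coord X a (delta_mx i j, 0))
    (\matrix_(i, j) coord X a (0, delta_mx i j)) Y = coord X a (to_pair Y).
  have -> : to_pair Y = \sum_i \sum_j (complex.Re (Y i j) *: (delta_mx i j, 0)
      + complex.Im (Y i j) *: (0, delta_mx i j)).
    have fstS (I : Type) (r : seq I) (F : I -> VT) :
        (\sum_(i <- r) F i).1 = \sum_(i <- r) (F i).1.
      by elim: r => [|i r IH]; rewrite ?big_nil // !big_cons -IH.
    have sndS (I : Type) (r : seq I) (F : I -> VT) :
        (\sum_(i <- r) F i).2 = \sum_(i <- r) (F i).2.
      by elim: r => [|i r IH]; rewrite ?big_nil // !big_cons -IH.
    rewrite [RHS]surjective_pairing; congr (_, _).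
    - rewrite fstS [LHS]matrix_sum_delta; apply: eq_bigr => i _.
      rewrite fstS; apply: eq_bigr => j _.
      by rewrite mxE /= scaler0 addr0.
    - rewrite sndS [LHS]matrix_sum_delta; apply: eq_bigr => i _.
      rewrite sndS; apply: eq_bigr => j _.
      by rewrite mxE /= scaler0 add0r.
  rewrite linear_sum; apply: eq_bigr => i _; rewrite linear_sum; apply: eq_bigr => j _.
  by rewrite linearD !linearZ /= !mxE.
split.
- by rewrite /= of_pairK.
- by move=> a; apply/UP; rewrite (basis_mem XU) // mem_nth // size_tuple.
- by move=> a b; rewrite cE to_pairK coord_free ?(basis_free XU) // eq_sym.
- move=> Y Ym; have YU : to_pair Y \in U by apply/UP; rewrite of_pairK.
  transitivity (of_pair (to_pair Y)); first by rewrite of_pairK.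
  rewrite [X in of_pair X](coord_basis XU YU) of_pair_sum.
  by apply: eq_bigr => a _; rewrite cE.
Qed.

End RealBasis.

(** * Products of exponentials *)

(** The hypothesis makes the matrix differ from the identity by an operator of
    norm at most 1/2 for the sup norm. The rows may come from different
    points, which is what the mean value theorem provides. *)
Lemma near_identity_inj (R : realFieldType) D (m : 'I_D -> 'I_D -> R) (z : 'I_D -> R) :
  (forall a b, `|m a b - (a == b)%:R| <= (D * 2)%:R^-1) ->
  (forall a, \sum_b m a b * z b = 0) -> forall a, z a = 0.
Proof.
case: D m z => [|D] m z mI mz a; first by case: a.
pose a0 := [arg max_(b > a) `|z b|]%O.
have zmax b : `|z b| <= `|z a0|.
  by rewrite /a0; case: arg_maxP => // c _ /(_ b isT).
suff : `|z a0| <= 0.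
  by move=> z0; apply/eqP; rewrite -normr_le0; exact: le_trans (zmax a) z0.
have e : z a0 = \sum_b ((a0 == b)%:R - m a0 b) * z b.
  rewrite (eq_bigr (fun b => (a0 == b)%:R * z b - m a0 b * z b)); last first.
    by move=> b _; rewrite mulrBl.
  rewrite sumrB mz subr0 (bigD1 a0) //= eqxx mul1r big1 ?addr0 // => b /negbTE ne.
  by rewrite eq_sym ne mul0r.
have h : `|z a0| <= \sum_(b < D.+1) (D.+1 * 2)%:R^-1 * `|z a0|.
  rewrite {1}e; apply: le_trans (ler_norm_sum _ _ _) _; apply: ler_sum => b _.
  rewrite normrM; apply: ler_pM; [exact: normr_ge0|exact: normr_ge0| |exact: zmax].
  by rewrite distrC; exact: mI.
have c1 : (D.+1%:R : R) * (D.+1 * 2)%:R^-1 = 2^-1.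
  by rewrite natrM invfM mulrA mulfV ?pnatr_eq0 // mul1r.
move: h; rewrite sumr_const card_ord -[leRHS]mulr_natl mulrA c1 => h.
have : `|z a0| - 2^-1 * `|z a0| <= 0 by rewrite subr_le0.
rewrite -{1}[`|z a0|]mul1r -mulrBl pmulr_rle0 //; lra.
Qed.

Section Lines.
Context {R : realType}.
Local Notation C := R[i].

Lemma is_mxderive_line (V : normedModType R) m n (h : V -> 'M[C]_(m, n)) (z v : V)
    (t : R) dh : is_mxderive (z + t *: v) v h dh ->
  is_mxderive (t : R^o) 1 (fun s : R^o => h (z + s *: v)) dh.
Proof.
move=> hD i j; have [[d1 e1] [d2 e2]] := hD i j.
by split; [rewrite -e1 | rewrite -e2]; exact: is_derive_line.
Qed.

End Lines.

Section ExponentialChart.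
Context {R : realType} {k : nat} {p_ : 'I_k -> nat}.
Local Notation C := R[i].
Local Notation n := (\sum_i p_ i)%N.
Local Notation M := ('M[C]_n).
Local Notation blk := (@tagnat.sig1 k p_).

Lemma smooth_real_form (V : normedModType R) (al be : 'M[R]_n) (f : V -> M) :
  smooth_mx setT f -> smooth setT (fun y => real_form al be (f y)).
Proof.
move=> fS; apply: smooth_sum => i; apply: smooth_sum => j.
have [f1 f2] := fS i j.
by apply: smoothD; apply: smoothM => //; exact: smooth_cst.
Qed.

Lemma is_derive_real_form (V : normedModType R) (al be : 'M[R]_n) (f : V -> M) x v df :
  is_mxderive x v f df ->
  is_derive x v (fun y => real_form al be (f y)) (real_form al be df).
Proof.
move=> fD.
pose g (y : V) : 'M[C]_n := \matrix_(i, j) (((al i j)%:C - 'i * (be i j)%:C) * f y i j).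
have gE (Y : M) : real_form al be Y =
    complex.Re (\sum_i \sum_j ((al i j)%:C - 'i * (be i j)%:C) * Y i j).
  rewrite /real_form cRe_sum; apply: eq_bigr => i _; rewrite cRe_sum.
  by apply: eq_bigr => j _; case: (Y i j) => a b /=; ring.
under [X in is_derive _ _ X]funext do rewrite gE.
rewrite gE; apply: (proj1 (is_cderive_sum _ _)) => i; apply: is_cderive_sum => j.
apply: is_cderive_eq (is_cderiveM (is_cderive_cst x v _) (fD i j)) _.
by rewrite mul0r add0r.
Qed.

Lemma smooth_mx_weight (V : normedModType R) m q (w : 'I_m -> 'I_q -> R)
    (f : V -> 'M[C]_(m, q)) :
  smooth_mx setT f ->
  smooth_mx setT (fun y => \matrix_(i, j) ((w i j)%:C * f y i j)).
Proof.
move=> fS i j; have [f1 f2] := fS i j; split.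
- rewrite (_ : (fun x => _) = fun x => w i j * complex.Re (f x i j)).
    by apply: smoothM => //; exact: smooth_cst.
  by apply/funext => x; rewrite mxE cReZ.
- rewrite (_ : (fun x => _) = fun x => w i j * complex.Im (f x i j)).
    by apply: smoothM => //; exact: smooth_cst.
  by apply/funext => x; rewrite mxE cImZ.
Qed.

Section Product.
Variables (D : nat) (E : 'I_D -> M).
Hypothesis Em : forall a, mspace (E a).

Fixpoint exp_prod (r : seq 'I_D) (y : 'rV[R]_D) : M :=
  if r is a :: r' then expm ((y 0 a)%:C *: E a) *m exp_prod r' y else 1%:M.

Lemma exp_prod_SU r y : SU (exp_prod r y).
Proof.
elim: r => [|a r IH]; first exact: SU1.
by apply: SUM IH; exact: mspace_SU_expm.
Qed.

Lemma is_diff_coord (a : 'I_D) (x : 'rV[R]_D) :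
  is_diff x (fun y : 'rV[R]_D => y 0 a) (fun y : 'rV[R]_D => y 0 a).
Proof.
have lin : linear (fun y : 'rV[R]_D => y 0 a : R) by move=> c y z; rewrite !mxE.
pose l : {linear 'rV[R]_D -> R} := HB.pack (fun y : 'rV[R]_D => y 0 a : R)
  (GRing.isLinear.Build _ _ _ _ _ lin).
apply: DiffDef; first exact: differentiable_coord.
rewrite (_ : (fun y : 'rV[R]_D => y 0 a) = l) // diff_lin //.
exact: coord_continuous.
Qed.

Lemma smooth_exp_prod r : smooth_mx setT (exp_prod r).
Proof.
elim: r => [|a r IH]; first exact: smooth_mx_cst.
apply: smooth_mxM IH; have [Es _] := (mspaceP _).1 (Em a).
exact (@smooth_expm R n (E a) Es 'rV[R]_D (fun y => y 0 a) (is_diff_coord a)).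
Qed.

(** On the axis a all other factors are exp 0. *)
Lemma exp_prod_axis r a (t : R) : uniq r ->
  exp_prod r (t *: delta_mx 0 a) = if a \in r then expm (t%:C *: E a) else 1%:M.
Proof.
have [Es _] := (mspaceP _).1 (Em a).
elim: r => [//|b r IH] /= /andP[br ur]; rewrite (IH ur) inE !mxE eqxx /=.
case: (a =P b) => [ab|/eqP ab] /=.
  by rewrite -ab (negbTE (_ : a \notin r)) ?ab // eqxx mulr1 mulmx1.
have [Esb _] := (mspaceP _).1 (Em b).
by rewrite eq_sym (negbTE ab) mulr0 (expm0 Esb) mul1mx.
Qed.

(** Only the values on the axis a enter the partial derivative. *)
Lemma exp_prod_derive0 a :
  derive_mx (exp_prod (enum 'I_D)) 0 (delta_mx 0 a) = E a.
Proof.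
set h := exp_prod _; have [Es _] := (mspaceP _).1 (Em a).
have hD := smooth_mx_is_derive (delta_mx 0 a) (smooth_exp_prod (enum 'I_D))
  (Logic.I : setT (0 + (0 : R) *: delta_mx 0 a)).
have D1 := is_mxderive_line hD.
have D2 := is_mxderive_expm Es 0.
rewrite (expm0 Es) mulmx1 in D2.
rewrite -[X in derive_mx _ X]addr0 -[X in derive_mx _ (_ + X)](scale0r (delta_mx 0 a)).
apply: is_mxderive_unique D1 _.
rewrite (_ : (fun s : R^o => _) = fun s : R^o => expm (s%:C *: E a)); first exact: D2.
by apply/funext => s; rewrite add0r exp_prod_axis ?enum_uniq ?mem_enum.
Qed.

Lemma exp_prod0 r : exp_prod r 0 = 1%:M.
Proof.
elim: r => [//|a r IH] /=; rewrite IH mulmx1 mxE.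
by have [Es _] := (mspaceP _).1 (Em a); rewrite expm0.
Qed.

End Product.
End ExponentialChart.

(** * A parametrization adapted to a basis *)

Lemma near_forall2 T (F : set_system T) {FF : Filter F} D (P : 'I_D -> 'I_D -> T -> Prop) :
  (forall a b, \forall y \near F, P a b y) -> \forall y \near F, forall a b, P a b y.
Proof.
move=> H; apply: (@filter_forall _ _ (fun a => [set y | forall b, P a b y])) => a.
by apply: (@filter_forall _ _ (fun b => [set y | P a b y])) => b; exact: H.
Qed.

Lemma ball0_convex (R : realType) (V : normedModType R) (r : R) (y z : V) (t : R) :
  ball (0 : V) r y -> ball (0 : V) r z -> 0 <= t <= 1 -> ball (0 : V) r (z + t *: (y - z)).
Proof.
rewrite -ball_normE /ball_ /= !sub0r !normrN => yr zr /andP[t0 t1].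
have -> : z + t *: (y - z) = (1 - t) *: z + t *: y.
  by rewrite scalerBr scalerBl scale1r addrA addrAC.
apply: le_lt_trans (ler_normD _ _) _; rewrite !normrZ (ger0_norm t0).
rewrite ger0_norm ?subr_ge0 //.
apply: (@le_lt_trans _ _ (Num.max `|y| `|z|)); last by rewrite gt_max yr zr.
have my : `|y| <= Num.max `|y| `|z| by rewrite le_max lexx.
have mz : `|z| <= Num.max `|y| `|z| by rewrite le_max lexx orbT.
apply: (@le_trans _ _ ((1 - t) * Num.max `|y| `|z| + t * Num.max `|y| `|z|)).
  by apply: lerD; apply: ler_wpM2l; rewrite ?subr_ge0.
by rewrite -mulrDl subrK mul1r.
Qed.

Lemma mulmx_commute_conj (F : pzRingType) n (g kap Delta P G : 'M[F]_n) :
  kap *m Delta = Delta *m kap -> kap *m P = 1%:M ->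
  (g *m kap) *m Delta *m (P *m G) = g *m Delta *m G.
Proof.
move=> kD kP; rewrite -(mulmxA g) kD !mulmxA -(mulmxA _ kap) kP.
by rewrite mulmx1.
Qed.

Section Chart.
Context {R : realType} {k : nat} {p_ : 'I_k -> nat}.
Local Notation C := R[i].
Local Notation n := (\sum_i p_ i)%N.
Local Notation M := ('M[C]_n).
Local Notation blk := (@tagnat.sig1 k p_).

Variables (D : nat) (E : 'I_D -> M) (al be : 'I_D -> 'M[R]_n).
Local Notation c := (fun a => real_form (al a) (be a)).
Hypothesis Em : forall a, mspace (E a).
Hypothesis cE : forall a b, c a (E b) = (a == b)%:R.
Hypothesis spanE : forall Y, mspace Y -> Y = \sum_a (c a Y)%:C *: E a.

Definition chart : 'rV[R]_D -> M := exp_prod E (enum 'I_D).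
Local Notation h := chart.
Let hS : smooth_mx setT h := smooth_exp_prod Em (enum 'I_D).
Let hSU y : SU (h y). Proof. exact: exp_prod_SU. Qed.
Let h0 : h 0 = 1%:M. Proof. exact: exp_prod0. Qed.

Definition chart_frame b y : M := off_block blk ((h y)^t* *m derive_mx h y (delta_mx 0 b)).
Local Notation theta := chart_frame.

Lemma smooth_chart_frame b : smooth_mx setT (theta b).
Proof.
have e A : off_block blk A = \matrix_(p, q) ((if blk p == blk q then 0 else 1 : R)%:C * A p q).
  apply/matrixP => p q; rewrite !mxE; case: ifP => _; last by rewrite mul1r.
  by apply: complex_ext; rewrite ?cReZ ?cImZ /= mul0r.
rewrite (_ : theta b = fun y => \matrix_(p, q) ((if blk p == blk q then 0 else 1 : R)%:C *
    ((h y)^t* *m derive_mx h y (delta_mx 0 b)) p q)).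
  apply: smooth_mx_weight; apply: smooth_mxM; first exact: smooth_mx_trC.
  exact: smooth_mx_derive.
by apply/funext => y; rewrite /theta e.
Qed.

Lemma chart_frame0 b : theta b 0 = E b.
Proof.
rewrite /theta h0 trmx1 map_mx1 mul1mx exp_prod_derive0 // off_block_id //.
by have /mspaceP[] := Em b.
Qed.

Lemma chart_diff_o y v : diff_o h y v = \sum_b (v 0 b)%:C *: theta b y.
Proof.
rewrite /diff_o proj_mE (derive_mx_coord v hS (Logic.I : setT y)).
exact: off_block_mulsum.
Qed.

Lemma chart_frame_mspace b y : mspace (theta b y).
Proof.
apply/mspaceP; split; last exact: zero_diag_off_block.
have s : ((h y)^t* *m derive_mx h y (delta_mx 0 b))^t* =
    - ((h y)^t* *m derive_mx h y (delta_mx 0 b)).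
  apply: maurer_cartan_skew (smooth_mx_is_derive _ hS (Logic.I : setT y)).
  by near=> z; case: (hSU z).
rewrite /theta; move: (_ *m _) s => W Ws; apply/matrixP => p q; rewrite !mxE eq_sym.
case: eqP => _; first by rewrite rmorph0 oppr0.
by have /matrixP/(_ p q) := Ws; rewrite !mxE.
Unshelve. all: by end_near. Qed.

Lemma mspace_sum (I : Type) (r : seq I) (e : I -> R) (Y : I -> M) :
  (forall i, mspace (Y i)) -> mspace (\sum_(i <- r) (e i)%:C *: Y i).
Proof.
move=> Ym; apply/mspaceP; split.
  rewrite trC_sum -sumrN; apply: eq_bigr => i _.
  by have /mspaceP[-> _] := Ym i; rewrite scalerN.
move=> p q pq; rewrite summxE big1 // => i _; rewrite mxE.
by have /mspaceP[_ ->] := Ym i; rewrite ?mulr0.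
Qed.

Let J a b y := c a (theta b y).

Lemma smooth_J a b : smooth setT (J a b).
Proof. exact/smooth_real_form/smooth_chart_frame. Qed.

Let Delta : M := block_label.
Let wt p q : R := ((val (blk q))%:R - (val (blk p))%:R)^-1.
Let Theta (Y : M) : M := \matrix_(p, q) ((wt p q)%:C * Y p q).
Let f a y := c a (Theta (h y *m Delta *m (h y)^t*)).

Lemma smooth_f a : smooth setT (f a).
Proof.
apply: smooth_real_form; apply: smooth_mx_weight.
apply: smooth_mxM; last exact: smooth_mx_trC.
by apply: smooth_mxM => //; exact: smooth_mx_cst.
Qed.

(** Off the diagonal blocks [Y, D] multiplies the entry (p, q) by the
    difference of the labels of q and p, which is invertible; Theta divides by
    it. *)
Lemma Theta_lie (Y : M) : zero_diag blk Y -> Theta (lie Y Delta) = Y.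
Proof.
move=> Y0; apply/matrixP => p q; rewrite mxE.
case: (blk p =P blk q) => [e|ne].
  rewrite /wt e subrr invr0 Y0 //.
  by apply: complex_ext; rewrite ?cReZ ?cImZ mul0r.
pose x : R := (val (blk q))%:R - (val (blk p))%:R.
have x0 : x != 0.
  by rewrite subr_eq0 eqr_nat val_eqE eq_sym; apply/eqP.
have -> : lie Y Delta p q = x%:C * Y p q.
  have e (m : nat) : ((m%:R : R)%:C) = m%:R :> C by rewrite rmorph_nat.
  have sub (A B : M) : (A - B) p q = A p q - B p q by rewrite mxE; congr (_ + _); rewrite mxE.
  by rewrite /lie sub mul_mx_diag mul_diag_mx !mxE rmorphB /= !e mulrBl mulrC.
rewrite mulrA -rmorphM /= (_ : wt p q * x = 1) ?rmorph1 ?mul1r //.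
by rewrite /wt mulVf.
Qed.

(** The derivative of h D h^-1 at 0 in the direction b is [E_b, D]. *)
Lemma f_derive0 a b : 'D_(delta_mx 0 b) (f a) 0 = (a == b)%:R.
Proof.
have hD := smooth_mx_is_derive (delta_mx 0 b) hS (Logic.I : setT 0).
have gD := is_mxderiveM (is_mxderiveMr Delta hD) (is_mxderive_trC hD).
have eD := exp_prod_derive0 Em b.
have := is_derive_real_form (al a) (be a) (is_mxderive_weight (fun p q => (wt p q)%:C) gD).
move=> [_ ->]; rewrite -cE; congr (real_form _ _ _).
have /mspaceP[Es E0] := Em b.
rewrite -[RHS](Theta_lie E0) /Theta h0 mul1mx trmx1 map_mx1 mulmx1.
by rewrite [derive_mx _ _ _]eD Es mulmxN.
Qed.

(** Elements of K commute with the label matrix, so h D h^-1 depends on the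
    coset only. *)
Lemma f_coset a y z : act (h y) origin = act (h z) origin -> f a y = f a z.
Proof.
move=> /(act_origin_eqP (hSU y) (hSU z)) /SKP[kS kB]; rewrite /f.
have -> : h z = h y *m ((h y)^t* *m h z) by rewrite SU_mulVK.
move: (_ *m h z) kS kB => kap [kU _] kB.
have kD : kap *m Delta = Delta *m kap by exact/block_label_commuteP.
congr (real_form _ _ (Theta _)); rewrite trCM; apply: esym.
exact: mulmx_commute_conj kD (unitaryVr kU).
Qed.

(** On a ball around 0 the Jacobian of f and the matrix of the frame in the
    basis E are both close to the identity. The first gives injectivity on
    cosets, by the mean value theorem on the segment joining two points; the
    second shows that the frame stays a basis of m. *)
Lemma chart_parametrization : (0 < D)%N -> exists2 r : R, 0 < r &
  parametrization (ball (0 : 'rV[R]_D) r) h.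
Proof.
(* The closeness to the identity asked by near_identity_inj. *)
move=> Dpos; pose eps : R := (D * 2)%:R^-1.
have eps0 : 0 < eps by rewrite invr_gt0 ltr0n muln_gt0 Dpos.
have nJ : \forall y \near (0 : 'rV[R]_D), forall a b, `|J a b y - (a == b)%:R| <= eps.
  apply: (@near_forall2 _ (nbhs (0 : 'rV[R]_D)) _ D
    (fun a b y => `|J a b y - (a == b)%:R| <= eps)) => a b.
  have cJ : {for (0 : 'rV[R]_D), continuous (J a b)}.
    by exact: (smooth_J a b 0%N (0 : 'rV[R]_D) Logic.I).
  move/cvgrPdist_le: cJ => /(_ _ eps0).
  have J0 : J a b 0 = (a == b)%:R by rewrite -cE -chart_frame0.
  by apply: filterS => y; rewrite distrC J0.
have nf : \forall y \near (0 : 'rV[R]_D), forall a b,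
    `|'D_(delta_mx 0 b) (f a) y - (a == b)%:R| <= eps.
  apply: (@near_forall2 _ (nbhs (0 : 'rV[R]_D)) _ D
    (fun a b y => `|'D_(delta_mx 0 b) (f a) y - (a == b)%:R| <= eps)) => a b.
  have cf : {for (0 : 'rV[R]_D), continuous (fun y => 'D_(delta_mx 0 b) (f a) y)}.
    by exact: (smooth_derive (delta_mx 0 b) (smooth_f a) 0%N (0 : 'rV[R]_D) Logic.I).
  move/cvgrPdist_le: cf => /(_ _ eps0).
  by apply: filterS => y; rewrite distrC f_derive0.
have : nbhs (0 : 'rV[R]_D) [set y | (forall a b, `|J a b y - (a == b)%:R| <= eps) /\
    (forall a b, `|'D_(delta_mx 0 b) (f a) y - (a == b)%:R| <= eps)].
  exact: (filterI nJ nf).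
move=> /nbhs_ballP [r /= r0 hr].
exists r; first exact: r0.
split.
- exact: ball_open.
- by split; [exact: smooth_mx_sub hS | move=> y _; split=> //].
- move=> y z; rewrite !inE => yU zU /f_coset fE.
  have seg (t : R) : 0 <= t <= 1 -> ball (0 : 'rV[R]_D) r (z + t *: (y - z)).
    exact: ball0_convex.
  have yz : z + 1 *: (y - z) = y by rewrite scale1r addrC subrK.
  have mv a : exists t : R, 0 < t < 1 /\ 'D_(y - z) (f a) (z + t *: (y - z)) = 0.
    have fd x : differentiable (f a) x by have [+ _] := smooth_f a 1%N; apply.
    have [t t01 e] := @mvt_line R 'rV[R]_D (f a) z (y - z) 1 ltr01 (fun t _ => fd _).
    exists t; split; first exact: t01.
    by move: e; rewrite yz mul1r fE subrr => <-.
  have [t tP] := choice mv.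
  have : forall b, (y - z) 0 b = 0.
    apply: (@near_identity_inj R D
      (fun a b => 'D_(delta_mx 0 b) (f a) (z + t a *: (y - z)))).
    + move=> a b; have [/andP[t0 t1] _] := tP a.
      by have [_ /(_ a b)] := hr _ (seg (t a) ltac:(by rewrite !ltW)).
    + move=> a; have [_ e] := tP a; rewrite -[RHS]e derive_coord.
        by apply: eq_bigr => b _; rewrite mulrC.
      by have [+ _] := smooth_f a 1%N; apply.
  by move=> e; apply/rowP => b; have := e b; rewrite !mxE => /eqP; rewrite subr_eq0 => /eqP.
- move=> y yU; have [Jy _] := hr y yU.
  have cdiff a v : c a (diff_o h y v) = \sum_b J a b y * v 0 b.
    rewrite chart_diff_o real_form_sum; apply: eq_bigr => b _; exact: mulrC.
  have dm v : mspace (diff_o h y v).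
    by rewrite chart_diff_o; apply: mspace_sum => b; exact: chart_frame_mspace.
  split.
  + by move=> v _; exact: dm.
  + move=> v v' _ _ e.
    have : forall b, (v - v') 0 b = 0.
      apply: (near_identity_inj Jy) => a.
      transitivity (c a (diff_o h y v) - c a (diff_o h y v')); last by rewrite e subrr.
      apply: etrans _ (esym (f_equal2 (fun s t : R => s - t) (cdiff a v) (cdiff a v'))).
      rewrite -sumrB; apply: eq_bigr => b _.
      have vv : (v - v') 0 b = v 0 b - v' 0 b by rewrite !mxE.
      by rewrite vv mulrBr.
    by move=> e'; apply/rowP => b; have := e' b; rewrite !mxE => /eqP; rewrite subr_eq0 => /eqP.
  + move=> Y Ym.
    (* The transpose of J, since coordinates are row vectors. *)
    pose Jm : 'M[R]_D := \matrix_(b, a) J a b y.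
    have JU : Jm \in unitmx.
      rewrite unitmxE unitfE; apply/det0P => -[v v0 vJ]; case/eqP: v0.
      apply/rowP => b; rewrite [RHS]mxE; apply: (near_identity_inj Jy) => a.
      have vJa : (v *m Jm) 0 a = 0 by rewrite vJ mxE.
      apply: etrans _ vJa; rewrite [RHS]mxE.
      by apply: eq_bigr => b' _; rewrite [Jm _ _]mxE mulrC.
    exists ((\row_a c a Y) *m invmx Jm) => //.
    rewrite [LHS](spanE (dm _)) [RHS](spanE Ym); apply: eq_bigr => a _.
    suff -> : c a (diff_o h y ((\row_a c a Y) *m invmx Jm)) = c a Y by [].
    rewrite cdiff.
    have /rowP/(_ a) : (\row_a c a Y) *m invmx Jm *m Jm = \row_a c a Y.
      by rewrite mulmxKV.
    rewrite [in RHS]mxE => <-; rewrite [RHS]mxE.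
    by apply: eq_bigr => b _; rewrite [Jm _ _]mxE mulrC.
Qed.

End Chart.

(** * Geodesics force the bracket to vanish *)

Section Necessity.
Context {R : realType} {k : nat} {p_ : 'I_k -> nat}.
Local Notation C := R[i].
Local Notation n := (\sum_i p_ i)%N.
Local Notation M := ('M[C]_n).
Local Notation blk := (@tagnat.sig1 k p_).

Lemma lie_skew (X Y : M) : X^t* = - X -> Y^t* = - Y -> (lie X Y)^t* = - lie X Y.
Proof.
move=> Xs Ys; rewrite /lie trCD trCN !trCM Xs Ys !mulNmx !mulmxN !opprK.
by rewrite opprB.
Qed.

Lemma weight_skew (lam : 'I_k -> 'I_k -> R) (X : M) :
  is_lambda lam -> mspace X ->
  (weight blk (fun i j => (lam i j)%:C) X)^t* = - weight blk (fun i j => (lam i j)%:C) X.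
Proof.
move=> lamP /mspaceP[Xs X0]; apply/matrixP => a b; rewrite !mxE.
have conjZ (x : R) (z : C) : Num.conj (x%:C * z) = x%:C * Num.conj z.
  by apply: complex_ext; rewrite ?cReJ ?cImJ ?cReZ ?cImZ ?cReJ ?cImJ ?mulrN.
rewrite conjZ.
case: (blk a =P blk b) => [e|/eqP ne].
  by rewrite !X0 // rmorph0 !mulr0 oppr0.
have [_ ->] := lamP _ _ ne.
by rewrite (skew_entry b a Xs) mulrN opprK.
Qed.

(** L is orthogonal to itself. *)
Lemma mspace_orthogonal_eq0 d (E : 'I_d -> M) (c : 'I_d -> R) (L : M) :
  mspace L -> L = \sum_a (c a)%:C *: E a ->
  (forall a, complex.Re (\tr (E a *m L)) = 0) -> L = 0.
Proof.
move=> Lm LE orth.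
pose one : 'I_k -> 'I_k -> R := fun _ _ => 1.
have oneP : is_lambda one by move=> i j _; rewrite /one ltr01.
apply: (metric_o_eq0 oneP Lm); have [Ls L0] := (mspaceP _).1 Lm.
have S0 : \sum_a c a * mform one L (E a) = 0.
  apply: big1 => a _; rewrite /mform (_ : weight _ _ L = L).
    by rewrite mxtrace_mulC orth mulr0.
  by apply/matrixP => p q; rewrite mxE mul1r.
by rewrite metric_o_mform // {2}LE mform_sumr S0 mulr0.
Qed.

(** Write the geodesic equation of the curve at t = 0, in the chart whose
    first axis is the curve. *)
Lemma bracket_of_equigeodesic (A : M) : (0 < n)%N -> mspace A -> equigeodesic A ->
  forall lam, is_lambda lam -> lie A (weight blk (fun i j => (lam i j)%:C) A) = 0.
Proof.
move=> n0 Am Ageo lam lamP.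
have [->|A0] := eqVneq A 0; first by rewrite /lie mul0mx mulmx0 subrr.
have [d [E [al [be [E0 Em cE spanE]]]]] := mspace_basis Am A0.
have [r r0 par] := chart_parametrization Em cE spanE (ltn0Sn d).
have [_ geo] := Ageo lam lamP.
pose x (t : R) : 'rV[R]_d.+1 := t *: delta_mx 0 ord0.
pose I : set R := [set t | ball (0 : 'rV[R]_d.+1) r (x t)].
have xc : continuous x.
  by move=> t; apply: scalel_continuous.
have Io : open I.
  apply: (open_comp (f := x)); first by move=> t _; exact: xc.
  exact: ball_open.
have xS c : smooth (V := R^o) I (fun t => x t 0 c).
  apply: (@smooth_sub R R^o I setT) => //.
  rewrite (_ : (fun t => _) = fun t : R^o => t * (delta_mx 0 ord0 : 'rV[R]_d.+1) 0 c).
    apply: (@smoothM R R^o (fun t : R^o => t)); last exact: smooth_cst.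
    exact (@smooth_linear R R^o id (fun t => is_diff_id t)).
  by apply/funext => t; rewrite /x mxE.
have hx t : chart E (x t) = expm (t%:C *: A).
  by rewrite /chart /x (exp_prod_axis Em) ?enum_uniq // mem_enum E0.
have hI t : I t -> ball (0 : 'rV[R]_d.+1) r (x t) /\
    act (expm (t%:C *: A)) origin = act (chart E (x t)) origin.
  by move=> It; split; [exact: It | rewrite hx].
have x0 : x 0 = 0 by rewrite /x scale0r.
have I0 : I 0 by rewrite /I /= x0; exact: ballxx.
have eqn := geo d.+1 _ (chart E) I x par Io xS hI 0 I0.
have := (geodesic_equation_chart lamP par Am Io xS hI n0 I0).1 eqn.
rewrite x0 => orth.
have [As A0d] := (mspaceP _).1 Am.
have h0 : chart E 0 = 1%:M := exp_prod0 Em _.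
rewrite h0 trmx1 map_mx1 mul1mx mulmx1 in orth.
have Lm : mspace (lie A (weight blk (fun i j => (lam i j)%:C) A)).
  apply/mspaceP; split; first by apply: lie_skew => //; exact: weight_skew.
  by apply: zero_diag_lie_weight => //; exact: sym_weight_is_lambda.
apply: (mspace_orthogonal_eq0 Lm (spanE _ Lm)) => a.
have := orth a; rewrite mul1mx (exp_prod_derive0 Em) off_block_id; first exact.
by have /mspaceP[] := Em a.
Qed.

End Necessity.

(** * Trajectories of Killing fields *)

Lemma conj_eq_commute (F : pzRingType) n (a a' b b' L : 'M[F]_n) :
  a' *m a = 1%:M -> b' *m b = 1%:M -> a *m L *m a' = b *m L *m b' ->
  (b' *m a) *m L = L *m (b' *m a).
Proof.
move=> aa bb E; have aL : a *m L = b *m L *m b' *m a.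
  by rewrite -E -mulmxA aa mulmx1.
by rewrite -mulmxA aL !mulmxA bb mul1mx.
Qed.

Lemma mulmx_commute_mid (F : pzRingType) n (w w' Z L : 'M[F]_n) :
  Z *m L = L *m Z -> w *m Z *m L *m w' = w *m L *m (Z *m w').
Proof. by move=> ZL; rewrite -(mulmxA w) ZL !mulmxA. Qed.

Section Trajectories.
Context {R : realType} {k : nat} {p_ : 'I_k -> nat}.
Local Notation C := R[i].
Local Notation n := (\sum_i p_ i)%N.
Local Notation M := ('M[C]_n).
Local Notation blk := (@tagnat.sig1 k p_).

Lemma is_mxderive_flow (X g : M) (t : R) : mspace X ->
  is_mxderive (t : R^o) 1 (fun s : R^o => expm (s%:C *: X) *m g)
    (X *m (expm (t%:C *: X) *m g)).
Proof.
move=> /mspaceP[Xs _]; rewrite mulmxA; apply: is_mxderiveMr.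
exact: is_mxderive_expm.
Qed.

(** The derivative of exp(tX) g at t = 0 is X g. *)
Lemma killing_fieldE (X g : M) : mspace X ->
  killing_field X g = g *m off_block blk (g^t* *m (X *m g)) *m g^t*.
Proof.
move=> XM; have D := is_mxderive_flow g 0 XM.
rewrite /killing_field /diff_F /diff_o (is_mxderive_val D) proj_mE.
by have [Xs _] := (mspaceP _).1 XM; rewrite (expm0 Xs) mul1mx.
Qed.

Lemma trajectory_expm (X g : M) : mspace X -> SU g ->
  trajectory X (fun t : R => act (expm (t%:C *: X) *m g) origin).
Proof.
move=> XM gS; exists (fun t : R => expm (t%:C *: X) *m g); split.
  exact: lifts_expm.
move=> t; rewrite (killing_fieldE _ XM) /diff_F /diff_o.
by rewrite (is_mxderive_val (is_mxderive_flow g t XM)) proj_mE.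
Qed.

Lemma is_mxderive0_cst (w : R -> M) :
  (forall t : R, is_mxderive (t : R^o) 1 w 0) -> forall t, w t = w 0.
Proof.
move=> wD t; apply/matrixP => a b; apply: complex_ext.
- apply: (@is_derive_0_is_cst R (fun t => complex.Re (w t a b))) => s.
  by have [+ _] := wD s a b; rewrite mxE.
- apply: (@is_derive_0_is_cst R (fun t => complex.Im (w t a b))) => s.
  by have [_ +] := wD s a b; rewrite mxE.
Qed.

(** Comparing a trajectory with the flow avoids uniqueness of solutions: the
    conjugate of the label matrix by w = exp(-tX) h has derivative w [Z, D]
    w^-1 = 0. *)
Lemma trajectory_flow (X : M) (gamma : R -> set M) : mspace X -> trajectory X gamma ->
  exists2 g, SU g & forall t : R, gamma t = act (expm (t%:C *: X) *m g) origin.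
Proof.
move=> XM [h [[hS hE] hT]]; have [Xs X0] := (mspaceP _).1 XM.
have hSU t : SU (h t) by have [] := hE t Logic.I.
have hD t := smooth_mx_is_derive (x := t : R^o) 1 hS Logic.I.
pose h' t := derive_mx (V := R^o) h t 1.
pose Z t := (h t)^t* *m h' t - (h t)^t* *m (X *m h t).
have Zd t : block_diag blk (Z t).
  have := hT t; rewrite (killing_fieldE _ XM) /diff_F /diff_o proj_mE -/(h' t).
  have cancel (A : M) : (h t)^t* *m (h t *m A *m (h t)^t*) *m h t = A.
    have [hU _] := hSU t.
    by rewrite -!mulmxA unitaryVl // mulmx1 mulmxA unitaryVl // mul1mx.
  move=> eqf.
  have eqo := etrans (esym (cancel _))
    (etrans (congr1 (fun A => (h t)^t* *m A *m h t) eqf) (cancel _)).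
  move=> a b ne; have /matrixP/(_ a b) := eqo.
  rewrite [LHS]mxE [RHS]mxE (negbTE ne) => eab.
  have sub (A B : M) : (A - B) a b = A a b - B a b by rewrite mxE; congr (_ + _); rewrite mxE.
  by rewrite /Z sub eab subrr.
have Zs t : (Z t)^t* = - Z t.
  have s1 : ((h t)^t* *m h' t)^t* = - ((h t)^t* *m h' t).
    apply: (maurer_cartan_skew (V := R^o)) (hD t).
    by near=> s; case: (hSU s).
  have s2 : ((h t)^t* *m (X *m h t))^t* = - ((h t)^t* *m (X *m h t)).
    by rewrite !trCM trmxCK Xs mulmxN mulNmx mulmxA.
  by rewrite /Z trCD trCN s1 s2 opprD.
pose w t := (expm (t%:C *: X))^t* *m h t.
have wD t : is_mxderive (t : R^o) 1 w (w t *m Z t).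
  have D := is_mxderiveM (V := R^o) (is_mxderive_trC (is_mxderive_expm Xs t)) (hD t).
  apply: is_mxderive_eq D _.
  rewrite /w /Z mulmxBr -!mulmxA !(SU_mulVK _ (hSU t)) trCM Xs.
  by rewrite mulmxN mulNmx addrC mulmxA.
have qD t : is_mxderive (t : R^o) 1 (fun s => w s *m block_label *m (w s)^t*) 0.
  have D := is_mxderiveM (V := R^o) (is_mxderiveMr block_label (wD t)) (is_mxderive_trC (wD t)).
  apply: is_mxderive_eq D _.
  have /block_label_commuteP cZ := Zd t.
  rewrite (trCM (w t) (Z t)) Zs mulNmx mulmxN.
  apply/eqP; rewrite subr_eq0; apply/eqP.
  exact: mulmx_commute_mid cZ.
have qC t := is_mxderive0_cst qD t.
have w0 : w 0 = h 0 by rewrite /w (expm0 Xs) trmx1 map_mx1 mul1mx.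
have wSU t : SU (w t).
  by apply: SUM => //; apply: SUV; exact: mspace_SU_expm.
exists (h 0) => [//|t]; have [_ ->] := hE t Logic.I.
have hw : h t = expm (t%:C *: X) *m w t by rewrite (SU_mulVK _ (mspace_SU_expm t XM)).
suff wh : act (h 0) origin = act (w t) origin.
  by rewrite hw -(act_mul _ (w t)) -(act_mul _ (h 0)) wh.
apply: (act_origin_eqP (hSU 0) (wSU t)).2; apply/SKP; split.
  by apply: SUM => //; exact: SUV.
apply/block_label_commuteP; rewrite -w0.
have [wU _] := wSU t; have [wU0 _] := wSU 0.
exact: conj_eq_commute (unitaryVl wU) (unitaryVl wU0) (qC t).
Unshelve. all: by end_near. Qed.

End Trajectories.

(** * Commensurate frequencies *)

Lemma mulmx_eigen_conj (F : comNzRingType) n (P Q D : 'M[F]_n) (v : 'rV[F]_n) (a : F) :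
  Q *m P = 1%:M -> v *m (P *m D *m Q) = a *: v -> (v *m P) *m D = a *: (v *m P).
Proof.
by move=> QP E; rewrite scalemxAl -E -!mulmxA QP mulmx1.
Qed.

Section Periods.
Context {R : realType}.
Local Notation C := R[i].

Lemma cexp_2pi_int (m : int) : cexp (pi *+ 2 * m%:~R : R) = 1.
Proof.
have c1 : cexp (pi *+ 2 : R) = 1 by rewrite /cexp cos2pi sin2pi.
have cN x : cexp x = 1 -> cexp (- x : R) = 1.
  by move=> x1; rewrite -cexpJ x1 rmorph1.
have cn (l : nat) : cexp (pi *+ 2 * l%:R : R) = 1.
  elim: l => [|l IH]; first by rewrite mulr0 cexp0.
  by rewrite -[l.+1]addn1 natrD mulrDr mulr1 cexpD IH c1 mulr1.
by case: (intP m) => [|l|l]; rewrite ?mulr0 ?cexp0 // ?mulrNz ?mulrN; last apply: cN; exact: cn.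
Qed.

(** Subtract a multiple of 2 pi to land in [0, 2 pi[, where cos takes the
    value 1 only at 0. *)
Lemma cexp_eq1 (x : R) : cexp x = 1 -> exists m : int, x = pi *+ 2 * m%:~R.
Proof.
move=> x1; have pi0 : 0 < pi *+ 2 :> R by rewrite mulrn_wgt0 ?pi_gt0.
pose m := Num.floor (x / (pi *+ 2)); exists m.
pose y := x - pi *+ 2 * m%:~R.
have cy : cos y = 1.
  have : cexp y = 1.
    by rewrite /y cexpD x1 mul1r -cexpJ cexp_2pi_int rmorph1.
  by move=> /(congr1 (@complex.Re R)).
have y0 : 0 <= y by rewrite subr_ge0 mulrC -ler_pdivlMr // floor_le.
have y1 : y < pi *+ 2.
  rewrite ltrBlDr -{1}[pi *+ 2]mulr1 -mulrDr mulrC -ltr_pdivrMr // addrC.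
  by rewrite -[1]/(1%:~R) -intrD; have /andP[] := floor_itv (x / (pi *+ 2)).
have cinj z : 0 <= z <= pi -> cos z = 1 -> z = 0 :> R.
  move=> z01 cz; apply: (@cos_inj R); rewrite ?in_itv //= ?lexx ?pi_ge0 //.
  by rewrite cz cos0.
have [ypi|piy] := leP y pi.
  have := cinj y; rewrite y0 ypi => /(_ isT cy) /eqP.
  by rewrite subr_eq0 => /eqP.
have : pi *+ 2 - y = 0.
  apply: cinj; last by rewrite cosB cos2pi sin2pi cy mul1r mul0r addr0.
  by rewrite subr_ge0 ltW //= lerBlDr mulr2n lerD2l ltW.
by move/eqP; rewrite subr_eq0 => /eqP e; rewrite e ltxx in y1.
Qed.

Lemma eigenvalue_spectral n (Q : 'M[C]_n) (th : 'I_n -> R) : Q \is unitarymx ->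
  forall a, eigenvalue (Q^t* *m diag_mx (\row_l (0 +i* th l)) *m Q) a <->
    exists l, a = 0 +i* th l.
Proof.
move=> QU a; set dd := \row_l _; split.
  move=> /eigenvalueP[v ve v0].
  have [w wE w0] : exists2 w : 'rV[C]_n, w *m diag_mx dd = a *: w & w != 0.
    exists (v *m Q^t*).
      exact: mulmx_eigen_conj (unitaryVr QU) ve.
    apply/eqP => w0; case/eqP: v0.
    by rewrite -[v]mulmx1 -(unitaryVl QU) mulmxA w0 mul0mx.
  have [l wl] : exists l, w 0 l != 0.
    apply/existsP; rewrite -[[exists _, _]]negbK negb_exists.
    apply: contra w0 => /forallP w0; apply/eqP/rowP => l; rewrite [RHS]mxE.
    by have := w0 l; rewrite negbK => /eqP.
  exists l; have /rowP/(_ l) := wE; rewrite mul_mx_diag !mxE mulrC => e.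
  by apply: esym; exact: (mulIf wl) e.
move=> [l ->]; apply/eigenvalueP; exists (row l Q).
  rewrite -row_mul !mulmxA unitaryVr // mul1mx; apply/rowP => j.
  by rewrite mul_diag_mx !mxE.
apply/eqP => r0; have : row l Q *m Q^t* = 0 by rewrite r0 mul0mx.
rewrite -row_mul unitaryVr // => /rowP/(_ l); rewrite !mxE eqxx => /eqP.
by rewrite oner_eq0.
Qed.

Lemma commensurate_imaginary (x y : R) :
  commensurate (0 +i* x : C) (0 +i* y) <->
  exists q r : rat, ((q != 0) || (r != 0)) /\ ratr q * x + ratr r * y = 0.
Proof.
have ratC (q : rat) : (ratr q : C) = (ratr q : R)%:C by rewrite fmorph_rat.
split=> -[q [r [qr E]]]; exists q, r; split=> //.
  by move: E; rewrite !ratC => /(congr1 (@complex.Im R)); rewrite cImD !cImZ.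
by rewrite !ratC; apply: complex_ext; rewrite ?cReD ?cImD ?cReZ ?cImZ //= !mulr0 addr0.
Qed.

(** All frequencies are rational multiples s_l of a nonzero one, and a common
    denominator N of the s_l gives the period. *)
Lemma common_period D (th : 'I_D -> R) :
  (forall a b, commensurate (0 +i* th a : C) (0 +i* th b)) ->
  exists2 T : R, 0 < T & forall l, cexp (T * th l) = 1.
Proof.
move=> H; have [/existsP[l0 t0]|] := boolP [exists l, th l != 0]; last first.
  rewrite negb_exists => /forallP t0; exists 1 => // l.
  by have := t0 l; rewrite negbK => /eqP ->; rewrite mulr0 cexp0.
have ratio l : exists s : rat, th l = ratr s * th l0.
  have /commensurate_imaginary[q [r [qr E]]] := H l l0.
  have q0 : q != 0.
    apply: contraTneq qr => q0; rewrite q0 eqxx /= negbK.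
    move: E => /eqP; rewrite q0 rmorph0 mul0r add0r mulf_eq0 (negbTE t0) orbF.
    by rewrite fmorph_eq0.
  exists (- (r / q)); apply: (mulfI (_ : ratr q != 0)).
    by rewrite fmorph_eq0.
  have e : q * - (r / q) = - r by rewrite mulrN mulrCA divff ?mulr1.
  rewrite mulrA -rmorphM e rmorphN mulNr.
  by apply/eqP; rewrite -addr_eq0 E.
have [s sE] := choice ratio.
(* A common denominator of the ratios. *)
pose N := \prod_l denq (s l).
have N0 : (0 < N)%R by apply: prodr_gt0 => l _; exact: denq_gt0.
have Nint l : exists m : int, (N%:~R * ratr (s l) : R) = m%:~R.
  rewrite /N (bigD1 l) //=; exists ((\prod_(i | i != l) denq (s i)) * numq (s l)).
  rewrite !intrM mulrAC mulrC; congr (_ * _).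
  by rewrite mulrC -[RHS](ratr_int R) numqE rmorphM /= ratr_int.
pose sg : int := sgz (th l0).
have absE : th l0 = sg%:~R * `|th l0| by rewrite -sgrEz; exact: numEsg.
have a0 : `|th l0| != 0 by rewrite normr_eq0.
exists (pi *+ 2 * N%:~R / `|th l0|).
  by rewrite divr_gt0 ?normr_gt0 // mulr_gt0 ?ltr0z // mulrn_wgt0 // pi_gt0.
move=> l; have [m mE] := Nint l; rewrite (sE l) [X in _ * (_ * X)]absE.
have -> : pi *+ 2 * N%:~R / `|th l0| * (ratr (s l) * (sg%:~R * `|th l0|)) =
    pi *+ 2 * (m * sg)%:~R.
  by rewrite intrM -mE; field.
exact: cexp_2pi_int.
Qed.

End Periods.

(** * A projection without zero off-diagonal entries *)

Lemma commute_diag_mxP (F : comNzRingType) n (K : 'M[F]_n) (d : 'rV[F]_n) :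
  K *m diag_mx d = diag_mx d *m K <-> forall a b, K a b * d 0 b = d 0 a * K a b.
Proof.
split=> [/matrixP E a b|E].
  by have := E a b; rewrite mul_mx_diag mul_diag_mx !mxE.
by apply/matrixP => a b; rewrite mul_mx_diag mul_diag_mx !mxE.
Qed.

Lemma mulmx_conj_cancel (F : pzRingType) n (Q Q' D m m' g' : 'M[F]_n) :
  g' = m' *m Q -> Q *m Q' = 1%:M -> g' *m (Q' *m D *m Q *m (Q' *m m)) = m' *m D *m m.
Proof.
move=> -> QQ; rewrite !mulmxA -(mulmxA m') QQ mulmx1 -!mulmxA.
by rewrite (mulmxA Q) QQ mul1mx.
Qed.

Lemma mulmx_commute_unconj (F : pzRingType) n (m m' D L : 'M[F]_n) :
  m *m m' = 1%:M -> (m' *m D *m m) *m L = L *m (m' *m D *m m) ->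
  D *m (m *m L *m m') = (m *m L *m m') *m D.
Proof.
move=> mm E; transitivity (m *m ((m' *m D *m m) *m L) *m m').
  by rewrite !mulmxA mm mul1mx.
by rewrite E -!mulmxA mm mulmx1.
Qed.

Section GenericProjection.
Context {R : realType} {n : nat}.
Local Notation C := R[i].
Local Notation M := ('M[C]_n).

Definition indicator_mx (S : pred 'I_n) : M := diag_mx (\row_a (S a)%:R).

(** The determinant is moved into one diagonal phase. *)
Lemma phase_correction (g : M) (a0 : 'I_n) : g \is unitarymx ->
  exists2 e : 'rV[C]_n, diag_mx e \is unitarymx & \det (g *m diag_mx e) = 1.
Proof.
move=> gU; pose z : C := Num.conj (\det g).
have zz : z * Num.conj z = 1.
  have := congr1 (fun A => \det A) (unitaryVl gU).
  by rewrite det_mulmx det1 det_map_mx det_tr /z conjCK.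
exists (\row_a (if a == a0 then z else 1)).
  apply/unitarymxP; rewrite tr_diag_mx map_diag_mx mulmx_diag.
  apply/matrixP => a b; rewrite !mxE; case: (a == b); rewrite ?mulr0n // !mulr1n.
  by case: ifP => _; rewrite ?zz // rmorph1 mulr1.
rewrite det_mulmx det_diag (bigD1 a0) //= big1 ?mulr1; last first.
  by move=> a /negbTE ne; rewrite mxE ne.
by rewrite mxE eqxx -zz mulrC /z conjCK.
Qed.

(** P is the unitary 1 + ((i - 1)/n) J, with J the matrix of ones: it has
    eigenvalue i on the constant vectors and 1 on their complement. The
    off-diagonal entries of the conjugated projection are real and nonzero
    when i and j are both in S or both outside S, since 0 < |S| < n, and have
    nonzero imaginary part otherwise. *)
Lemma generic_projection (S : pred 'I_n) : (exists a, S a) -> (exists a, ~~ S a) ->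
  exists2 P : M, P \is unitarymx &
    forall i j, i != j -> (P *m indicator_mx S *m P^t*) i j != 0.
Proof.
move=> [a1 h1] [a2 h2].
have n0 : (0 < n)%N by exact: leq_ltn_trans (ltn_ord a1).
pose N : R := n%:R; have N0 : 0 < N by rewrite ltr0n.
have Nn0 : N != 0 by rewrite gt_eqF.
pose c : C := (- N^-1) +i* N^-1.
pose P : M := 1%:M + const_mx c.
have NC : (n%:R : C) = N%:C by rewrite /N rmorph_nat.
(* Unitarity of 1 + c J. *)
have cc : c + Num.conj c + n%:R * (c * Num.conj c) = 0.
  rewrite NC; apply: complex_ext;
    rewrite ?cReD ?cImD ?cReZ ?cImZ ?cReM ?cImM ?cReJ ?cImJ /c /=; by field.
have PE i j : P i j = (i == j)%:R + c by rewrite !mxE.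
have PJ i j : (P^t*) i j = (j == i)%:R + Num.conj c.
  by rewrite 2!mxE PE rmorphD rmorph_nat.
have sumd (i : 'I_n) (f : 'I_n -> C) : \sum_a (i == a)%:R * f a = f i.
  rewrite (bigD1 i) //= eqxx mul1r big1 ?addr0 // => a /negbTE ne.
  by rewrite eq_sym ne mul0r.
have expand (x : 'I_n -> C) i j : \sum_a P i a * x a * (P^t*) a j =
    (i == j)%:R * x i + Num.conj c * x i + c * x j + c * Num.conj c * \sum_a x a.
  transitivity (\sum_a ((i == a)%:R * (x a * (j == a)%:R) + (i == a)%:R * (Num.conj c * x a)
      + (j == a)%:R * (c * x a) + c * Num.conj c * x a)).
    by apply: eq_bigr => a _; rewrite PE PJ; ring.
  by rewrite !big_split /= !sumd -mulr_sumr eq_sym mulrC.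
exists P.
  apply/unitarymxP/matrixP => i j; rewrite [LHS]mxE [RHS]mxE.
  transitivity (\sum_a P i a * 1 * (P^t*) a j).
    by apply: eq_bigr => a _; rewrite mulr1.
  have S1 : \sum_(a < n) (1 : C) = n%:R by rewrite sumr_const card_ord.
  rewrite (expand (fun=> 1)) S1.
  transitivity ((i == j)%:R + (c + Num.conj c + n%:R * (c * Num.conj c))).
    by ring.
  by rewrite cc addr0.
move=> i j ij.
pose s : R := \sum_a (S a)%:R.
have sC : \sum_a ((S a)%:R : C) = s%:C.
  by rewrite /s rmorph_sum /=; apply: eq_bigr => a _; rewrite rmorph_nat.
have s0 : 0 < s.
  rewrite /s (bigD1 a1) //= h1; apply: ltr_wpDr; last exact: ltr01.
  by apply: sumr_ge0.
have sN : s < N.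
  have -> : N = \sum_(a < n) 1 by rewrite sumr_const card_ord.
  rewrite /s (bigD1 a2) //= (negbTE h2) add0r [ltRHS](bigD1 a2) //=.
  apply: ltr_pwDl; first exact: ltr01.
  by apply: ler_sum => a _; case: (S a).
have -> : (P *m indicator_mx S *m P^t*) i j =
    Num.conj c * (S i)%:R + c * (S j)%:R + c * Num.conj c * s%:C.
  rewrite mxE; under eq_bigr => a _ do rewrite mul_mx_diag [X in X * _]mxE [(\row_ _ _) _ _]mxE.
  by rewrite (expand (fun a => (S a)%:R)) (negbTE ij) mul0r add0r sC.
have Ni : 0 < N^-1 by rewrite invr_gt0.
have Nis : 0 < N^-1 * (1 - N^-1 * s).
  by apply: mulr_gt0 => //; rewrite subr_gt0 mulrC ltr_pdivrMr // mul1r.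
have sNi : 0 < s * (N^-1 * N^-1) by rewrite !mulr_gt0.
apply/eqP => E0.
have := congr1 (@complex.Re R) E0; have := congr1 (@complex.Im R) E0.
rewrite /c; case: (S i); case: (S j); rewrite ?mulr1 ?mulr0 ?addr0 ?add0r /= => e1 e2; nra.
Qed.

End GenericProjection.

(** * Closed Killing fields *)

Section ClosedFields.
Context {R : realType} {k : nat} {p_ : 'I_k -> nat}.
Local Notation C := R[i].
Local Notation n := (\sum_i p_ i)%N.
Local Notation M := ('M[C]_n).
Local Notation blk := (@tagnat.sig1 k p_).

(** A common period of the eigenvalues of X is a period of the whole flow. *)
Lemma closed_of_commensurate (X : M) : mspace X ->
  commensurate_eigenvalues X -> closed_killing_field X.
Proof.
move=> XM Xc gamma /(trajectory_flow XM)[g gS gE].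
have [Xs _] := (mspaceP _).1 XM.
have [Q [th [QU XE]]] := skew_spectral Xs.
have [|T T0 TE] := @common_period R n th.
  by move=> a b; apply: Xc; rewrite XE; apply/(eigenvalue_spectral th QU); [exists a|exists b].
have ET : expm (T%:C *: X) = 1%:M.
  rewrite XE (expm_spectral _ _ QU) /spectral_exp.
  have -> : diag_mx (\row_l cexp (T * th l)) = 1%:M.
    by apply/matrixP => i j; rewrite !mxE TE.
  by rewrite mulmx1 unitaryVl.
exists T => // t; rewrite !gE (expmD Xs) ET.
by rewrite mulmx1.
Qed.

(** The trajectory starts at g K with g chosen so that, in an eigenbasis of X,
    the conjugate by g of the projection on one block has no zero entry off
    the diagonal; commuting with it forces the diagonal matrix exp(TX) to be
    scalar. *)
Lemma commensurate_of_closed (X : M) (i0 : 'I_k) : mspace X ->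
  (exists a, blk a == i0) -> (exists a, blk a != i0) ->
  closed_killing_field X -> commensurate_eigenvalues X.
Proof.
move=> XM ex1 ex2 Xcl; have [Xs X0] := (mspaceP _).1 XM.
have [Q [th [QU XE]]] := skew_spectral Xs.
have [P PU Pgen] := @generic_projection R n (fun a => blk a == i0) ex1 ex2.
have [a0 _] := ex1.
have g0U : Q^t* *m P \is unitarymx by exact (mul_unitarymx (unitary_conj QU) PU).
have [e eU edet] := phase_correction a0 g0U.
pose phi : M := diag_mx e; pose g := Q^t* *m P *m phi.
have gS : SU g by split; [exact: mul_unitarymx g0U eU | exact: edet].
have [T T0 TE] := Xcl _ (trajectory_expm XM gS).
(* Periodicity at t = 0 says exactly that kap is in K. *)
pose kap := g^t* *m (expm (T%:C *: X) *m g).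
have kB : block_diag blk kap.
  have := TE 0; rewrite add0r (expm0 Xs) mul1mx => /esym E.
  have ES : SU (expm (T%:C *: X) *m g) by apply: SUM gS; exact: mspace_SU_expm.
  by have /SKP[] := (act_origin_eqP gS ES).1 E.
pose Pi : M := indicator_mx (fun a => blk a == i0).
have kPi : kap *m Pi = Pi *m kap.
  apply/commute_diag_mxP => a b; rewrite [X in _ * X = _]mxE [X in _ = X * _]mxE.
  by case: (blk a =P blk b) => [->|/eqP/kB ->]; rewrite ?mul0r ?mulr0 // mulrC.
pose d l := cexp (T * th l); pose D : M := diag_mx (\row_l d l).
pose m := P *m phi.
have mU : m \is unitarymx by exact (mul_unitarymx PU eU).
have kE : kap = m^t* *m D *m m.
  rewrite /kap XE (expm_spectral _ _ QU) /spectral_exp -/D /g -(mulmxA (Q^t*)) -/m.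
  have gE : (Q^t* *m m)^t* = m^t* *m Q.
    exact (etrans (trCM _ _) (congr1 (fun Z => m^t* *m Z) (trmxCK Q))).
  exact: mulmx_conj_cancel gE (unitaryVr QU).
have DY : D *m (P *m Pi *m P^t*) = (P *m Pi *m P^t*) *m D.
  have phiPi : phi *m Pi = Pi *m phi by rewrite /phi /Pi /indicator_mx diag_mxC.
  rewrite -(mulmx_commute_conj P (P^t*) phiPi (unitaryVr eU)) -/m -trCM -/m.
  apply: mulmx_commute_unconj (unitaryVr mU) _.
  rewrite kE in kPi; exact kPi.
have dE i j : i != j -> d i = d j.
  move=> ij; have Yij := Pgen i j ij.
  have := (commute_diag_mxP _ _).1 (esym DY) i j.
  rewrite [X in _ * X = _]mxE [X in _ = X * _]mxE [RHS]mulrC => E.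
  exact: esym (mulfI Yij E).
have dA i j : d i = d j by case: (eqVneq i j) => [->//|/dE].
have th0 : \sum_l th l = 0.
  by apply: (sum_spectral_trace QU); rewrite -XE; exact: tr_zero_diag X0.
pose N : R := n%:R.
have N0 : N != 0 by rewrite pnatr_eq0 -lt0n; exact: leq_ltn_trans (ltn_ord a0).
(* The common eigenvalue of exp(TX) has n-th power equal to the determinant
   of exp(TX), that is exp(T tr X) = 1. *)
have per l : cexp (N * T * th l) = 1.
  have -> : N * T * th l = \sum_(j < n) T * th l.
    by rewrite sumr_const card_ord -mulr_natl mulrA.
  transitivity (cexp (T * \sum_l th l)); last by rewrite th0 mulr0 cexp0.
  rewrite mulr_sumr !cexp_sum.
  by apply: eq_bigr => j _; exact: dA.
have [mm mE] := choice (fun l => cexp_eq1 (per l)).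
move=> a b; rewrite XE => /(eigenvalue_spectral th QU)[i ->].
move=> /(eigenvalue_spectral th QU)[j ->]; apply/commensurate_imaginary.
have NT : N * T != 0 by rewrite mulf_neq0 // gt_eqF.
have [ti|ti] := eqVneq (th i) 0.
  by exists 1, 0; rewrite oner_eq0 ti rmorph0 mulr0 mul0r addr0.
exists (mm j)%:~R, (- (mm i)%:~R); split.
  apply/orP; right; rewrite oppr_eq0 intr_eq0; apply: contraNneq ti => m0.
  have := mE i; rewrite m0 mulr0 => /eqP; rewrite mulf_eq0 (negbTE NT) /=.
  by [].
rewrite rmorphN /= !ratr_int; apply: (mulfI NT); rewrite mulr0.
transitivity ((mm j)%:~R * (N * T * th i) - (mm i)%:~R * (N * T * th j)).
  by ring.
by rewrite !mE; ring.
Qed.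

End ClosedFields.

Theorem theorem1p2 (R : realType) (k : nat) (n_ : 'I_k -> nat)
    (hk : (2 <= k)%N) (hn : forall i, (1 <= n_ i)%N)
    (A : 'M[R[i]]_(\sum_i n_ i)) (hA : mspace A) :
  (equigeodesic A <->
     forall i j m : 'I_k, i != j -> j != m -> i != m ->
       submxblock A i j *m submxblock A j m = 0)
  /\
  (commensurate_eigenvalues A <-> closed_killing_field A).
Proof.
have k0 : (0 < k)%N by exact: ltnW hk.
pose i0 := Ordinal k0; pose i1 := Ordinal hk.
have ex1 : exists a, @tagnat.sig1 k n_ a == i0.
  by exists (tagnat.Rank i0 (Ordinal (hn i0))); rewrite tagnat.Rank1K.
have ex2 : exists a, @tagnat.sig1 k n_ a != i0.
  by exists (tagnat.Rank i1 (Ordinal (hn i1))); rewrite tagnat.Rank1K.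
have n0 : (0 < \sum_i n_ i)%N by case: ex1 => a _; exact: leq_ltn_trans (ltn_ord a).
have A0 : zero_diag (@tagnat.sig1 k n_) A by have /mspaceP[] := hA.
split.
  rewrite -(lie_weight_eq0 A0); split; first exact: bracket_of_equigeodesic.
  exact: equigeodesic_of_bracket.
split; first exact: closed_of_commensurate.
exact: commensurate_of_closed hA ex1 ex2.
Qed.
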